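(* For every mean-payoff game $\mathcal{G}$, every vertex $v$ of $\mathcal{G}$, and every rational $c$: if $\mathsf{ASV}(v)>c$, then there exists a strategy $\sigma_0$ of Player 0 with pseudopolynomial memory such that $\mathsf{ASV}(\sigma_0)(v)>c$.
   Context: An arena $(V,E,\langle V_0,V_1\rangle,w_0,w_1)$ consists of a finite set $V$ of vertices, a set $E\subseteq V\times V$ of edges such that every vertex has at least one successor, a partition of $V$ into $V_0$ (Player 0) and $V_1$ (Player 1), and weight functions $w_0,w_1:E\to\mathbb{Z}$. A mean-payoff game $\mathcal{G}$ is played on such an arena. A play is an infinite path $\pi=\pi_0\pi_1\dots$; a history is a nonempty finite prefix of a play. The payoff of Player $i\in\{0,1\}$ is $\underline{\mathsf{MP}}_i(\pi)=\liminf_{k\to\infty}\frac1k w_i(\pi_0\dots\pi_k)$, where $w_i$ of a history is the sum of the $w_i$-weights of its edges. A strategy of Player $i$ maps each history ending in a vertex of $V_i$ to a successor of that last vertex; $\Sigma_i$ is the set of strategies of Player $i$. $\mathsf{Out}_v(\sigma_0,\sigma_1)$ is the unique play from $v$ consistent with $\sigma_0$ and $\sigma_1$. A strategy has memory $M$ if it can be realized as the output of a finite state machine with $M$ states. For $\epsilon>0$, $\mathsf{BR}^{\epsilon}_{1}(\sigma_0)$ is the set of $\sigma_1\in\Sigma_1$ such that for all $v\in V$ and all $\sigma_1'\in\Sigma_1$: $\underline{\mathsf{MP}}_1(\mathsf{Out}_v(\sigma_0,\sigma_1))>\underline{\mathsf{MP}}_1(\mathsf{Out}_v(\sigma_0,\sigma_1'))-\epsilon$.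 Then $\mathsf{ASV}(\sigma_0)(v)=\sup_{\epsilon>0}\inf_{\sigma_1\in\mathsf{BR}^{\epsilon}_1(\sigma_0)}\underline{\mathsf{MP}}_0(\mathsf{Out}_v(\sigma_0,\sigma_1))$ and $\mathsf{ASV}(v)=\sup_{\sigma_0\in\Sigma_0}\mathsf{ASV}(\sigma_0)(v)$. Weights and $c$ are given in binary. Pseudopolynomial means polynomial in the size of the input $(\mathcal{G},v,c)$ and in the absolute values of the integers occurring in it (weights, numerator and denominator of $c$). *)

(* Defs.v *)
From HB Require Import structures.
From mathcomp Require Import all_boot all_order all_algebra.
From mathcomp Require Import all_classical all_reals all_analysis.

Set Implicit Arguments.
Unset Strict Implicit.
Unset Printing Implicit Defensive.

Import Order.TTheory GRing.Theory Num.Theory.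

Local Open Scope classical_set_scope.
Local Open Scope ring_scope.

(* Player 1 owns the complement of [V0].  The weight functions are total on
   pairs of vertices, but only their values on edges are ever used. *)
Record arena := Arena {
  vertex :> finType;
  edge : rel vertex;
  edge_total : forall x : vertex, exists y : vertex, edge x y;
  V0 : {set vertex};
  w0 : vertex -> vertex -> int;
  w1 : vertex -> vertex -> int
}.
Arguments edge {_}.
Arguments V0 _ : clear implicits.
Arguments w0 {_}.
Arguments w1 {_}.

Definition V1 (G : arena) : {set G} := ~: V0 G.

(* A history is a sequence [x :: p] with [path edge x p]: as every vertex has a
   successor, these are exactly the nonempty finite prefixes of plays.  Values
   of [move] outside the histories ending in [U] are irrelevant. *)
Record strategy (G : arena) (U : {set G}) := Strategy {
  move :> seq G -> G;
  moveP : forall (x : G) (p : seq G),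
    path edge x p -> last x p \in U -> edge (last x p) (move (x :: p))
}.

Fixpoint out_history (G : arena) (s0 : strategy (V0 G)) (s1 : strategy (V1 G))
    (v : G) (n : nat) : seq G :=
  if n is m.+1 then
    let h := out_history s0 s1 v m in
    rcons h (if last v h \in V0 G then s0 h else s1 h)
  else [:: v].

Definition Out (G : arena) (s0 : strategy (V0 G)) (s1 : strategy (V1 G))
    (v : G) (n : nat) : G :=
  last v (out_history s0 s1 v n).

(* Taken in the extended reals, so that [limn_einf], [ereal_sup] and
   [ereal_inf] are total; the term of index 0 is [0 / 0 = 0]. *)
Definition MP (R : realType) (G : arena) (w : G -> G -> int) (pi : nat -> G) :
    \bar R :=
  limn_einf (fun k : nat =>
    (((\sum_(j < k) w (pi j) (pi j.+1))%:~R / k%:R : R)%:E)).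

Definition BR (R : realType) (G : arena) (eps : R) (s0 : strategy (V0 G)) :
    set (strategy (V1 G)) :=
  [set s1 | forall (v : G) (s1' : strategy (V1 G)),
    (MP R w1 (Out s0 s1' v) - eps%:E < MP R w1 (Out s0 s1 v))%E].

Definition ASV_strat (R : realType) (G : arena) (s0 : strategy (V0 G)) (v : G) :
    \bar R :=
  ereal_sup [set ereal_inf [set MP R w0 (Out s0 s1 v) | s1 in BR eps s0]
            | eps in [set eps : R | 0 < eps]].

Definition ASV (R : realType) (G : arena) (v : G) : \bar R :=
  ereal_sup [set ASV_strat R s0 v | s0 in [set: strategy (V0 G)]].

(* A Mealy machine: reading the current vertex, it outputs the next move and
   updates its state. *)
Record machine (G : arena) (M : nat) := Machine {
  init : 'I_M;
  upd : 'I_M -> G -> 'I_M;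
  outp : 'I_M -> G -> G
}.

Definition has_memory (G : arena) (U : {set G}) (s : strategy U) (M : nat) :
    Prop :=
  exists m : machine G M, forall (x : G) (p : seq G),
    path edge x p -> last x p \in U ->
    s (x :: p) = outp m (foldl (upd m) (init m) (belast x p)) (last x p).

(* Binary digits of [`|z|], plus a sign bit. *)
Definition bitsize (z : int) : nat := (up_log 2 `|z|.+1).+1.

(* The vertices (name and owner), the edges (two names, two weights), the
   initial vertex, and the threshold, all in binary. *)
Definition input_size (G : arena) (c : rat) : nat :=
  let name := up_log 2 #|G| in
  (#|G| * name.+1
   + \sum_(e : G * G | edge e.1 e.2)
       (2 * name + bitsize (w0 e.1 e.2) + bitsize (w1 e.1 e.2))
   + name + bitsize (numq c) + bitsize (denq c))%N.

Definition input_magnitude (G : arena) (c : rat) : nat :=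
  maxn (\max_(e : G * G | edge e.1 e.2) maxn `|w0 e.1 e.2| `|w1 e.1 e.2|)
       (maxn `|numq c| `|denq c|).

(* Main.v *)
Require Import Defs.
From HB Require Import structures.
From mathcomp Require Import all_boot all_order all_algebra.
From mathcomp Require Import all_classical all_reals all_analysis.
From mathcomp Require Import ring lra zify.

Set Implicit Arguments.
Unset Strict Implicit.
Unset Printing Implicit Defensive.

Import Order.TTheory GRing.Theory Num.Theory.

Local Open Scope ring_scope.

(** Write [c = p / q], and call a loop a closed walk of the arena.

    What [ASV v > c] gives.  Some strategy [s0] of Player 0 comes with a
    threshold [b] and a value [c' > c] such that every play consistent with
    [s0] whose payoff for Player 1 exceeds [b] pays at least [c'] to Player 0,
    and some consistent play [pi] does pay more than [b] to Player 1
    ([ASV_gt_witness]).  Memory is saved separately along [pi] and after a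
    deviation from [pi].

    Deviations.  After a deviation Player 0 keeps Player 1 away from payoffs
    (less than [c'] for Player 0, more than [b] for Player 1).  A positional
    strategy does this from a vertex exactly when no loop that it leaves
    reachable has both its sums of [c' - w0] and of [w1 - b] positive.  The
    alternative, by induction on the number of edges of Player 0, is that
    Player 1 can make both sums drift to infinity ([safe_or_trapped]): the
    winning condition of Player 1 is closed under interleaving, so Player 1
    can play two winning strategies in turn, one for each way in which Player 0
    resolves a choice.  That alternative contradicts the property of [s0] at
    every vertex to which Player 1 can deviate from [pi] ([deviation_safe]).

    Rounding.  Let [r] be the greatest fraction not above [b] with denominator at
    most a pseudopolynomial [D].  The payoffs of Player 1 that
    matter are the means of short loops and, on the segments between the mean
    payoffs of two short loops, the values where Player 0 gets [c]; all of them
    are fractions with denominator at most [D].  Hence the positional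
    strategies above stay punishing when [b] is replaced by [r] and [c'] by
    [c], up to a slack that can be chosen at the end: a plane separation
    argument in each strongly connected component gives [k >= 0] such that
    [w1 - r <= k (w0 - c)] holds on average over long walks
    ([component_tradeoff], [punishing_bound]).

    The main play.  The edges that [pi] uses infinitely often contain a loop
    of mean payoffs more than [c] and more than [r].  By the same separation
    argument one short loop is enough, or suitable repetitions of two short
    loops and of the walks connecting them.  On the segment between the two
    loops, the value where Player 0 gets [c] exceeds [b >= r]; as it and [r]
    have bounded denominators, it exceeds [r] by an amount that is not too small, so pseudopolynomially many repetitions make up for
    the cost of the connecting walks ([short_rewarding_loop]).

    The machine follows a path to that loop, then the loop, and switches to
    the punishing positional strategy of the first unexpected vertex
    ([follow_strategy]).  With a tolerance smaller than the gap between the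
    mean payoff of the loop for Player 1 and [r], each approximate best
    response either follows the loop or is punished into paying more than [c]
    to Player 0 ([follow_value]). *)


(** * Sums of weights along walks *)
Section Walks.
Context {T : finType}.

(** The walk starts at [x] and then visits the vertices of [p], in the format
    of [path]. *)
Fixpoint wsum {V : zmodType} (g : T -> T -> V) (x : T) (p : seq T) : V :=
  if p is y :: p' then g x y + wsum g y p' else 0.

Lemma wsum_cat (V : zmodType) (g : T -> T -> V) x p q :
  wsum g x (p ++ q) = wsum g x p + wsum g (last x p) q.
Proof. by elim: p x => [|y p IH] x /=; rewrite ?add0r // IH addrA. Qed.

Lemma wsumD (V : zmodType) (g h : T -> T -> V) x p :
  wsum (fun y z => g y z + h y z) x p = wsum g x p + wsum h x p.
Proof. by elim: p x => [|y p IH] x /=; rewrite ?addr0 // IH addrACA. Qed.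

Lemma wsumZ (R : comNzRingType) (k : R) (g : T -> T -> R) x p :
  wsum (fun y z => k * g y z) x p = k * wsum g x p.
Proof. by elim: p x => [|y p IH] x /=; rewrite ?mulr0 // IH mulrDr. Qed.

Lemma wsum_const (V : zmodType) (k : V) x p :
  wsum (fun _ _ => k) x p = k *+ size p.
Proof. by elim: p x => [|y p IH] x //=; rewrite IH mulrS. Qed.

Lemma wsum_intr (R : pzRingType) (g : T -> T -> int) x p :
  wsum (fun y z => (g y z)%:~R : R) x p = (wsum g x p)%:~R.
Proof. by elim: p x => [|y p IH] x //=; rewrite IH rmorphD. Qed.

Lemma eq_wsum (V : zmodType) (g h : T -> T -> V) x p :
  (forall y z, g y z = h y z) -> wsum g x p = wsum h x p.
Proof. by move=> gh; elim: p x => [|y p IH] x //=; rewrite IH gh. Qed.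

Lemma norm_wsum_le (R : realDomainType) (e : rel T) (g : T -> T -> R) (K : R) x p :
  (forall y z, e y z -> `|g y z| <= K) -> path e x p ->
  `|wsum g x p| <= K *+ size p.
Proof.
move=> gK; elim: p x => [|y p IH] x /=; first by rewrite normr0.
case/andP=> exy /IH {}IH; rewrite mulrS.
by apply: le_trans (ler_normD _ _) _; apply: lerD => //; apply: gK.
Qed.

(** A constant for all walks, used where only the existence of a bound matters. *)
Lemma norm_wsum_bounded (R : realDomainType) (g : T -> T -> R) :
  exists2 K : R, 0 <= K & forall x p, `|wsum g x p| <= K *+ size p.
Proof.
exists (\sum_(e : T * T) `|g e.1 e.2|); first by apply: sumr_ge0.
move=> x p; apply: (@norm_wsum_le _ (fun _ _ => true)); last first.
  by elim: p x => //=.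
move=> y z _; rewrite (bigD1 (y, z)) //= lerDl; exact: sumr_ge0.
Qed.

Lemma wsum_play (V : zmodType) (g : T -> T -> V) (rho : nat -> T) i m :
  wsum g (rho i) [seq rho l | l <- iota i.+1 m]
  = \sum_(l < m) g (rho (i + l)%N) (rho (i + l).+1).
Proof.
elim: m i => [|m IH] i /=; first by rewrite big_ord0.
rewrite big_ord_recl /= addn0 IH; congr (_ + _).
by apply: eq_bigr => l _; rewrite /bump leq0n add1n addnS addSn.
Qed.

Lemma path_play (e : rel T) (rho : nat -> T) i m :
  (forall l, (i <= l < i + m)%N -> e (rho l) (rho l.+1)) ->
  path e (rho i) [seq rho l | l <- iota i.+1 m].
Proof.
elim: m i => [|m IH] i er //=; rewrite er ?IH //=; last by lia.
by move=> l il; apply: er; lia.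
Qed.

Lemma last_play (rho : nat -> T) i m :
  last (rho i) [seq rho l | l <- iota i.+1 m] = rho (i + m)%N.
Proof. by elim: m i => [|m IH] i /=; rewrite ?addn0 // IH addSnnS. Qed.

(** Among the first [#|T| + 1] vertices two coincide. *)
Lemma long_path_loop (x : T) (p : seq T) : (#|T| <= size p)%N ->
  exists p1 c p2, [/\ p = p1 ++ c ++ p2, c != [::], (size c <= #|T|)%N
    & last (last x p1) c = last x p1].
Proof.
move=> szp; pose q := take #|T| p.
have szq : size q = #|T| by rewrite size_takel.
have nu : ~~ uniq (x :: q).
  apply/negP => /card_uniqP /= cq.
  by have := max_card (mem (x :: q)); rewrite cq szq ltnn.
have [i [j [ij jq nij]]] := uniqPn x nu.
rewrite /= ltnS in jq.
exists (take i q), (drop i (take j q)), (drop j p).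
have jq' : (j <= #|T|)%N by rewrite -szq.
have ltk k : (k <= size q)%N -> last x (take k q) = nth x (x :: q) k.
  by move=> kq; rewrite (last_nth x) size_takel //; case: k kq => //= k kq; rewrite nth_take.
have e1 : take i q = take i (take j q) by rewrite take_takel // ltnW.
have e2 : take j q = take j p by rewrite take_takel.
split.
- by rewrite e1 catA cat_take_drop e2 cat_take_drop.
- by rewrite -size_eq0 size_drop size_takel // subn_eq0 -ltnNge.
- by rewrite size_drop size_takel // (leq_trans (leq_subr _ _)).
- have h : last x (take i q) = last x (take j q).
    by rewrite !ltk // ltnW // (leq_trans ij).
  by rewrite -last_cat {1}e1 cat_take_drop h.
Qed.

(** Cutting short loops out of a long walk never decreases its sum, and what
    remains in the end has fewer than [#|T|] edges. *)
Lemma wsum_bounded_of_short_loops (R : realDomainType) (e : rel T) (g : T -> T -> R) :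
  (forall x c, path e x c -> c != [::] -> (size c <= #|T|)%N -> last x c = x ->
     wsum g x c <= 0) ->
  exists K : R, forall x p, path e x p -> wsum g x p <= K.
Proof.
move=> short; have [K K0 gK] := norm_wsum_bounded g.
exists (K *+ #|T|) => x p; move: {2}(size p) (leqnn (size p)) => m.
elim: m p => [|m IH] p pm pp.
  apply: le_trans (le_trans (ler_norm _) (gK x p)) _.
  by rewrite ler_wpMn2l // (leq_trans pm).
case: (leqP #|T| (size p)) => szp; last first.
  apply: le_trans (le_trans (ler_norm _) (gK x p)) _.
  by rewrite ler_wpMn2l // ltnW.
have [p1 [c [p2 [pE cn szc lc]]]] := long_path_loop x szp.
move: pp; rewrite pE !cat_path lc => /and3P[pp1 pc pp2].
rewrite !wsum_cat lc.
have := IH (p1 ++ p2); rewrite cat_path wsum_cat pp1 pp2 => IH'.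
have h : (size (p1 ++ p2) <= m)%N.
  move: pm; rewrite pE !size_cat; case: (c) cn => //= *; lia.
have := IH' h isT; have := short _ _ pc cn szc lc; lra.
Qed.

Lemma wsum_flatten (V : zmodType) (g : T -> T -> V) x p k :
  last x p = x -> wsum g x (flatten (nseq k p)) = wsum g x p *+ k.
Proof.
by move=> lp; elim: k => //= k IH; rewrite wsum_cat lp IH mulrS.
Qed.

Lemma last_flatten x (p : seq T) k : last x p = x -> last x (flatten (nseq k p)) = x.
Proof. by move=> lp; elim: k => //= k IH; rewrite last_cat lp. Qed.

Lemma path_flatten (e : rel T) x p k : last x p = x -> path e x p ->
  path e x (flatten (nseq k p)).
Proof. by move=> lp pp; elim: k => //= k IH; rewrite cat_path lp pp. Qed.

Lemma size_flatten_nseq (p : seq T) k : size (flatten (nseq k p)) = (k * size p)%N.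
Proof. by rewrite size_flatten /shape map_nseq sumn_nseq mulnC. Qed.

Lemma connect_short_path (e : rel T) x y : connect e x y ->
  exists p, [/\ path e x p, last x p = y & (size p <= #|T|)%N].
Proof.
case/connectP=> p pp ->; case/shortenP: pp => q pq uq _.
exists q; split=> //; have /card_uniqP /= := uq.
by move=> cq; have := max_card (mem (x :: q)); rewrite cq => /ltnW.
Qed.

(** The connecting walk [r] does not depend on the numbers of repetitions, so
    its contribution becomes negligible when these grow. *)
Lemma repeat_two_loops (e : rel T) x1 c1 x2 c2 :
  path e x1 c1 -> last x1 c1 = x1 -> path e x2 c2 -> last x2 c2 = x2 ->
  connect e x1 x2 -> connect e x2 x1 ->
  exists r, [/\ path e x1 r, (size r <= 2 * #|T|)%N & forall k1 k2, exists c,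
    [/\ path e x1 c, last x1 c = x1,
      size c = (k1 * size c1 + k2 * size c2 + size r)%N
     & forall (V : zmodType) (g : T -> T -> V),
        wsum g x1 c = wsum g x1 c1 *+ k1 + wsum g x2 c2 *+ k2 + wsum g x1 r]].
Proof.
move=> p1 l1 p2 l2 /connect_short_path[r1 [pr1 lr1 sr1]].
move=> /connect_short_path[r2 [pr2 lr2 sr2]].
exists (r1 ++ r2); split; first by rewrite cat_path pr1 lr1.
  by rewrite size_cat; lia.
move=> k1 k2; exists (flatten (nseq k1 c1) ++ r1 ++ flatten (nseq k2 c2) ++ r2).
have fl1 := last_flatten k1 l1; have fl2 := last_flatten k2 l2.
rewrite !cat_path !last_cat fl1 lr1 fl2 lr2 !path_flatten // pr1 pr2.
split=> //; first by rewrite !size_cat !size_flatten_nseq; lia.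
move=> V g; rewrite !wsum_cat fl1 lr1 fl2 !wsum_flatten //.
by rewrite -!addrA; congr (_ + _); rewrite addrCA.
Qed.

End Walks.

(** * A plane separation argument *)
Section Farkas.
Variables (R : realFieldType) (I : finType) (P : pred I) (a b : I -> R).

(** Farkas' lemma in the plane for the half-open quadrant [0 <= a], [0 < b]:
    if the cone of the vectors [(a i, b i)] meets it, then one vector or two
    vectors already do so; otherwise a line of slope [- k] separates them. *)
Lemma planar_alternative :
  [\/ exists i, [/\ P i, 0 <= a i & 0 < b i],
      exists i j, [/\ P i, P j & [/\ 0 < a i, b i <= 0, a j < 0, 0 < b j & a j * b i < a i * b j]]
    | exists2 k : R, 0 <= k & forall i, P i -> k * a i + b i <= 0].
Proof.
case: (pickP (fun i => [&& P i, 0 <= a i & 0 < b i])) => [i /and3P[]|no1].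
  by move=> *; apply: Or31; exists i.
case: (pickP (fun ij : I * I => [&& P ij.1, P ij.2, 0 < a ij.1, b ij.1 <= 0, a ij.2 < 0,
    0 < b ij.2 & a ij.2 * b ij.1 < a ij.1 * b ij.2])) => [[i j] /= /and5P[? ? ? ? /and3P[? ? ?]]|no2].
  by apply: Or32; exists i, j.
apply: Or33.
(* The flattest admissible line: [k] is the largest of [0] and the ratios
   [b j / - a j], and the excluded pairs bound it from above. *)
pose r j := b j / - a j.
have [k [k0 kub katt]] : exists k : R, [/\ 0 <= k,
    forall j, P j -> a j < 0 -> r j <= k &
    k = 0 \/ exists j, [/\ P j, a j < 0, 0 < b j & k = r j]].
  case: (pickP (fun j => [&& P j, a j < 0 & 0 < b j])) => [j0 Pj0|no]; last first.
    exists 0; split=> //; last by left.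
    move=> j Pj aj; have := no j; rewrite Pj aj /= => /negbT; rewrite -leNgt => bj.
    by rewrite /r pmulr_lle0 // invr_gt0 oppr_gt0.
  have [j /and3P[Pj aj bj] jmax] :=
    @arg_maxP _ _ _ j0 (fun j => [&& P j, a j < 0 & 0 < b j]) r Pj0.
  exists (r j); split; last by right; exists j.
    by rewrite /r divr_ge0 ?oppr_ge0 ?ltW.
  move=> i Pi ai; case: (ltP 0 (b i)) => bi; first by apply: jmax; rewrite Pi ai bi.
  apply: (@le_trans _ _ 0); first by rewrite /r pmulr_lle0 // invr_gt0 oppr_gt0.
  by rewrite /r divr_ge0 ?oppr_ge0 ?ltW.
exists k => // i Pi; case: (ltrgt0P (a i)) => ai.
- have bi : b i <= 0.
    by have := no1 i; rewrite Pi (ltW ai) /= => /negbT; rewrite -leNgt.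
  case: katt => [->|[j [Pj aj bj ->]]]; first by rewrite mul0r add0r.
  have := no2 (i, j); rewrite /= Pi Pj ai bi aj bj /= => /negbT; rewrite -leNgt => h.
  have nj : 0 < - a j by rewrite oppr_gt0.
  rewrite /r -(ler_pM2l nj) mulr0 mulrDr mulrA mulrCA mulfV ?gt_eqF // mulr1.
  by move: h; lra.
- have := kub _ Pi ai; rewrite /r ler_pdivrMr ?oppr_gt0 //; lra.
- rewrite ai mulr0 add0r; have := no1 i; rewrite Pi ai lexx /= => /negbT.
  by rewrite -leNgt.
Qed.
End Farkas.

(** * Edges used infinitely often *)
Section Recurrence.
Context {T : finType} (rho : nat -> T).

(** A finite set of edges rather than a relation, so that constants can be
    maximised over all possible values. *)
Definition recurrent : {set T * T} :=
  [set e | `[< forall N, exists2 k, (N <= k)%N & rho k = e.1 /\ rho k.+1 = e.2 >]]%SET.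

Definition in_edges (F : {set T * T}) : rel T := fun x y => (x, y) \in F.

Lemma recurrentP x y : reflect (forall N, exists2 k, (N <= k)%N & rho k = x /\ rho k.+1 = y)
  (in_edges recurrent x y).
Proof. by rewrite /in_edges inE; exact: asboolP. Qed.

Lemma eventually_recurrent : exists N, forall k, (N <= k)%N -> in_edges recurrent (rho k) (rho k.+1).
Proof.
have /choice[N NP] : forall e : T * T, exists N, forall k, (N <= k)%N ->
    rho k = e.1 -> rho k.+1 = e.2 -> in_edges recurrent e.1 e.2.
  move=> [x y] /=; have [r|nr] := boolP (in_edges recurrent x y); first by exists 0%N.
  move: nr => /recurrentP /asboolPn/existsp_asboolPn[N nN].
  exists N => k Nk kx ky; exfalso; apply: nN; by exists k.
exists (\max_e N e)%N => k kN; apply: (NP (rho k, rho k.+1) k) => //.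
exact: leq_trans (leq_bigmax _) kN.
Qed.

Lemma recurrent_connect x y x' y' : in_edges recurrent x y -> in_edges recurrent x' y' ->
  connect (in_edges recurrent) x x'.
Proof.
move=> /recurrentP r /recurrentP r'; have [N NP] := eventually_recurrent.
have [k Nk [<- _]] := r N; have [k' kk' [<- _]] := r' k.
apply/connectP; exists [seq rho l | l <- iota k.+1 (k' - k)].
  by apply: path_play => l kl; apply: NP; lia.
by rewrite last_play subnKC.
Qed.

End Recurrence.

(** * Positional strategies for Player 0 against two energy conditions *)
Section Dichotomy.
Context {T : finType} {R : realType}.
Implicit Types e F : rel T.

Lemma mulrn_unbounded (d A : R) : 0 < d -> exists M, forall k, (M <= k)%N -> A < d *+ k.
Proof.
move=> d0; exists (Num.bound (`|A| / d)) => k Mk.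
apply: le_lt_trans (ler_norm A) _; rewrite -mulr_natr mulrC -ltr_pdivrMr //.
apply: lt_le_trans (archi_boundP _) _; first by rewrite divr_ge0 // ltW.
by rewrite ler_nat.
Qed.

(** The loops of length at most [#|T|] are finitely many, so their sums can be
    fed to [planar_alternative]; a separating line for them bounds all walks. *)
Lemma planar_walk_alternative F (f0 f1 : T -> T -> R) :
  [\/ exists x c, [/\ path F x c, c != [::], (size c <= #|T|)%N, last x c = x &
        0 <= wsum f0 x c /\ 0 < wsum f1 x c],
      exists x1 c1 x2 c2,
        [/\ [/\ path F x1 c1, c1 != [::], (size c1 <= #|T|)%N & last x1 c1 = x1],
            [/\ path F x2 c2, c2 != [::], (size c2 <= #|T|)%N & last x2 c2 = x2],
            0 < wsum f0 x1 c1 /\ wsum f1 x1 c1 <= 0,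
            wsum f0 x2 c2 < 0 /\ 0 < wsum f1 x2 c2 &
            wsum f0 x2 c2 * wsum f1 x1 c1 < wsum f0 x1 c1 * wsum f1 x2 c2]
    | exists2 k : R, 0 <= k & exists K : R, forall x p, path F x p ->
        k * wsum f0 x p + wsum f1 x p <= K].
Proof.
pose I : finType := (T * #|T|.-bseq T)%type.
pose P (i : I) := [&& path F i.1 i.2, val i.2 != [::] & last i.1 i.2 == i.1].
case: (@planar_alternative R I P (fun i => wsum f0 i.1 i.2) (fun i => wsum f1 i.1 i.2)).
- case=> -[x c] [/and3P[/= pc cn /eqP lc] h0 h1].
  by apply: Or31; exists x, c; split=> //; exact: size_bseq.
- case=> -[x1 c1] [[x2 c2]] [/and3P[/= pc cn /eqP lc] /and3P[/= pc' cn' /eqP lc'] [*]].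
  apply: Or32; exists x1, c1, x2, c2; split=> //; split=> //; exact: size_bseq.
- case=> k k0 kP; apply: Or33; exists k => //.
  have [] := @wsum_bounded_of_short_loops T R F (fun x y => k * f0 x y + f1 x y).
    move=> x c pc cn sc lc.
    have := kP (x, Bseq sc); rewrite /P /= pc cn lc eqxx => /(_ isT).
    by rewrite wsumD wsumZ.
  move=> K KP; exists K => x p /KP; by rewrite wsumD wsumZ.
Qed.

Section Game.
Variables (U : {set T}) (f0 f1 : T -> T -> R).

Definition obey (tau : T -> T) e : rel T :=
  fun x y => e x y && ((x \in U) ==> (y == tau x)).

(** [U] is the set of vertices of Player 0.  Player 1 would like the sums of
    [f0] and [f1] to grow together; repeating a loop that violates the second
    clause achieves this.  The loop is [c], and [q] leads to it. *)
Definition safe e u (tau : T -> T) :=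
  (forall x, x \in U -> e x (tau x)) /\
  forall q c, path (obey tau e) u (q ++ c) -> c != [::] ->
    last u (q ++ c) = last u q ->
    wsum f0 (last u q) c <= 0 \/ wsum f1 (last u q) c <= 0.

(** Player 1 holds two credits [r] and [s], which follow the sums of [f0 - d]
    and [f1 - d]; extra credit may be thrown away. *)
Definition step (d : R) (X : T -> R -> R -> Prop) x r s y :=
  exists r' s', [/\ r' <= r + f0 x y - d, s' <= s + f1 x y - d & X y r' s'].

(** A set [X] of vertices with credits within which Player 1 can stay: the
    credits then never become negative, so that both sums grow at rate [d]. *)
Definition trap e (d : R) (X : T -> R -> R -> Prop) :=
  forall x r s, X x r s -> [/\ 0 <= r, 0 <= s &
    if x \in U then forall y, e x y -> step d X x r s y
    else exists2 y, e x y & step d X x r s y].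

Definition trapped e u := exists d X, [/\ 0 < d, trap e d X & exists r s, X u r s].

(** Any way [mv] of playing for Player 0, with arbitrary memory, meets a play
    that stays in the trap. *)
Lemma play_in_trap e d X u r s (mv : seq T -> T) :
  trap e d X -> X u r s ->
  (forall p, path e u p -> last u p \in U -> e (last u p) (mv (u :: p))) ->
  exists rho : nat -> T, [/\ rho 0%N = u, forall k, e (rho k) (rho k.+1),
    forall k, rho k \in U -> rho k.+1 = mv (mkseq rho k.+1),
    forall k, d *+ k - r <= \sum_(j < k) f0 (rho j) (rho j.+1)
    & forall k, d *+ k - s <= \sum_(j < k) f1 (rho j) (rho j.+1)].
Proof.
move=> trapX Xu mvP.
(* A state is a history, without its first vertex, with the current credits. *)
pose S := (seq T * R * R)%type.
pose inv (t : S) := path e u t.1.1 /\ X (last u t.1.1) t.1.2 t.2.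
pose next (t t' : S) := exists y,
  [/\ t'.1.1 = rcons t.1.1 y, e (last u t.1.1) y,
     last u t.1.1 \in U -> y = mv (u :: t.1.1),
     t'.1.2 <= t.1.2 + f0 (last u t.1.1) y - d & t'.2 <= t.2 + f1 (last u t.1.1) y - d].
have /choice[nx nxP] : forall t, exists t', inv t -> inv t' /\ next t t'.
  move=> [[p a] b]; case: (pselect (inv (p, a, b))) => [[/= pp Xp]|]; last by exists (p, a, b).
  have [_ _] := trapX _ _ _ Xp.
  have main y : e (last u p) y -> (last u p \in U -> y = mv (u :: p)) ->
      step d X (last u p) a b y -> exists t', inv (p, a, b) -> inv t' /\ next (p, a, b) t'.
    move=> ey ym [a' [b' [aa bb Xy]]]; exists (rcons p y, a', b') => _.
    split; first by split=> /=; rewrite ?rcons_path ?pp ?last_rcons.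
    by exists y.
  case: ifP => xV0 => [h|[y ey sy]].
    have em : e (last u p) (mv (u :: p)) by apply: mvP.
    by apply: (main (mv (u :: p))) => //; apply: h.
  by apply: (main y) => //; rewrite xV0.
pose st k := iter k nx ([::], r, s).
have stI k : inv (st k).
  by elim: k => [|k IH]; [split | rewrite /st iterS; case: (nxP _ IH)].
have stN k : next (st k) (st k.+1) by rewrite /st iterS; case: (nxP _ (stI k)).
pose rho k := last u (st k).1.1.
have hist k : u :: (st k).1.1 = mkseq rho k.+1.
  elim: k => [|k IH] //; have [y [e1 _ _ _ _]] := stN k.
  rewrite /mkseq -[k.+2]addn1 iotaD map_cat -/(mkseq rho k.+1) -IH /= cats1 -rcons_cons.
  by rewrite add0n /rho e1 last_rcons rcons_cons.
have rhoS k : [/\ e (rho k) (rho k.+1), rho k \in U -> rho k.+1 = mv (mkseq rho k.+1),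
    (st k.+1).1.2 <= (st k).1.2 + f0 (rho k) (rho k.+1) - d &
    (st k.+1).2 <= (st k).2 + f1 (rho k) (rho k.+1) - d].
  have [y [e1 ? h ? ?]] := stN k.
  have -> : rho k.+1 = y by rewrite /rho e1 last_rcons.
  by rewrite -hist.
exists rho; split=> //.
- by move=> k; case: (rhoS k).
- by move=> k; case: (rhoS k).
- move=> k; have : d *+ k - r <= \sum_(j < k) f0 (rho j) (rho j.+1) - (st k).1.2.
    elim: k => [|k IH]; first by rewrite big_ord0 mulr0n !sub0r.
    rewrite big_ord_recr /= mulrS; have [_ _ + _] := rhoS k; move: IH; lra.
  have [h _ _] := trapX _ _ _ (stI k).2; lra.
- move=> k; have : d *+ k - s <= \sum_(j < k) f1 (rho j) (rho j.+1) - (st k).2.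
    elim: k => [|k IH]; first by rewrite big_ord0 mulr0n !sub0r.
    rewrite big_ord_recr /= mulrS; have [_ _ _] := rhoS k; move: IH; lra.
  have [_ h _] := trapX _ _ _ (stI k).2; lra.
Qed.

Lemma sum_iota_split (g : T -> T -> R) (rho : nat -> T) i m :
  \sum_(j < (i + m)%N) g (rho j) (rho j.+1) =
  \sum_(j < i) g (rho j) (rho j.+1) + wsum g (rho i) [seq rho l | l <- iota i.+1 m].
Proof. by rewrite wsum_play big_split_ord /=. Qed.

(** In the play against [tau] that stays in the trap some vertex recurs, and
    between two of its occurrences that are far apart both sums are positive. *)
Lemma safe_not_trapped e u tau : safe e u tau -> ~ trapped e u.
Proof.
move=> [tauV0 safeu] [d [X [d0 trapX [r [s Xu]]]]].
have [p _ pV|rho [rho0 rhoe rhom h0 h1]] :=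
    @play_in_trap e d X u r s (fun h => tau (last u h)) trapX Xu.
  exact: tauV0.
have rho_obey k : obey tau e (rho k) (rho k.+1).
  rewrite /obey rhoe /=; apply/implyP => kV; rewrite rhom //.
  by rewrite /mkseq -addn1 iotaD map_cat last_cat.
have [N NP] := eventually_recurrent rho.
pose i := N.
have [M0 M0P] := mulrn_unbounded (r + \sum_(j < i) f0 (rho j) (rho j.+1)) d0.
have [M1 M1P] := mulrn_unbounded (s + \sum_(j < i) f1 (rho j) (rho j.+1)) d0.
have [k ki [kx _]] := recurrentP rho _ _ (NP i (leqnn N)) (i.+1 + M0 + M1)%N.
pose m := (k - i)%N; have kE : k = (i + m)%N by rewrite subnKC //; lia.
pose q := [seq rho l | l <- iota 1 i]; pose c := [seq rho l | l <- iota i.+1 m].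
have lq : last u q = rho i by rewrite -rho0 /q last_play.
have lc : last (rho i) c = rho i by rewrite /c last_play -kE.
have := safeu q c; rewrite last_cat lq lc => -[] //.
- by rewrite cat_path lq -{1}rho0 !path_play.
- by rewrite -size_eq0 size_map size_iota; lia.
- have := h0 (i + m)%N; rewrite (sum_iota_split f0) -/c; have : (M0 <= i + m)%N by lia.
  by move=> /M0P; lra.
- have := h1 (i + m)%N; rewrite (sum_iota_split f1) -/c; have : (M1 <= i + m)%N by lia.
  by move=> /M1P; lra.
Qed.

Lemma step_le d d' X x r s y : d' <= d -> step d X x r s y -> step d' X x r s y.
Proof. by move=> dd [r' [s' [? ? ?]]]; exists r', s'; split=> //; lra. Qed.

(** When Player 0 has no choice, Player 1 walks to a loop with positive sums
    and repeats it. *)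
Lemma trapped_loop e u q c :
  (forall x y y', x \in U -> e x y -> e x y' -> y = y') ->
  path e u (q ++ c) -> c != [::] -> last u (q ++ c) = last u q ->
  0 < wsum f0 (last u q) c -> 0 < wsum f1 (last u q) c -> trapped e u.
Proof.
set z := last u q => det; rewrite cat_path last_cat -/z => /andP[pq pc] cn lc c0 c1.
pose d := Num.min (wsum f0 z c) (wsum f1 z c) / (size c)%:R.
have szc : 0 < (size c)%:R :> R by rewrite ltr0n lt0n size_eq0.
have d0 : 0 < d by rewrite divr_gt0 // lt_min c0 c1.
have dc : d *+ size c = Num.min (wsum f0 z c) (wsum f1 z c).
  by rewrite -mulr_natr divfK // gt_eqF.
pose g0 x y := f0 x y - d; pose g1 x y := f1 x y - d.
have gc0 : 0 <= wsum g0 z c.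
  by rewrite wsumD wsum_const mulNrn dc subr_ge0 ge_min lexx.
have gc1 : 0 <= wsum g1 z c.
  by rewrite wsumD wsum_const mulNrn dc subr_ge0 ge_min lexx orbT.
have [K0 K00 K0P] := norm_wsum_bounded g0; have [K1 K10 K1P] := norm_wsum_bounded g1.
pose m := maxn (size q) (size c).
(* A vertex is coupled with a walk [p] that remains to be done before the
   next visit of [z]; the credits must be at least a constant there. *)
pose X x a b := exists p, [/\ path e x p, last x p = z, (size p <= m)%N,
  K0 *+ m - wsum g0 x p <= a & K1 *+ m - wsum g1 x p <= b].
have cons x a b y p : path e x (y :: p) -> last x (y :: p) = z -> (size (y :: p) <= m)%N ->
    K0 *+ m - wsum g0 x (y :: p) <= a -> K1 *+ m - wsum g1 x (y :: p) <= b ->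
    e x y /\ step d X x a b y.
  rewrite /= => /andP[exy pp] lp sp ha hb; split=> //.
  exists (a + f0 x y - d), (b + f1 x y - d); split=> //; exists p; split=> //.
  - exact: ltnW.
  - by move: ha; rewrite /g0; lra.
  - by move: hb; rewrite /g1; lra.
exists d, X; split=> //; last first.
  exists (K0 *+ m - wsum g0 u q), (K1 *+ m - wsum g1 u q), q.
  by split=> //; rewrite leq_max leqnn.
move=> x a b [p [pp lp sp ha hb]]; split.
- have := K0P x p; have := ler_wpMn2l K00 sp; have := ler_norm (wsum g0 x p); lra.
- have := K1P x p; have := ler_wpMn2l K10 sp; have := ler_norm (wsum g1 x p); lra.
have [y [exy sy]] : exists y, e x y /\ step d X x a b y.
  case: p pp lp sp ha hb => [|y p] pp lp sp ha hb; last by exists y; apply: cons hb.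
  move: lp ha hb => /= xz; rewrite {}xz => ha hb.
  have szm : (size c <= m)%N by rewrite leq_max leqnn orbT.
  have ha' : K0 *+ m - wsum g0 z c <= a by lra.
  have hb' : K1 *+ m - wsum g1 z c <= b by lra.
  case: (c) cn pc lc szm ha' hb' => [|y c'] // _ pc' lc' szm ha' hb'.
  by exists y; apply: cons hb'.
case: ifP => xV; last by exists y.
by move=> y' exy'; rewrite (det _ _ _ xV exy' exy).
Qed.

Lemma trap_le e d d' X : d' <= d -> trap e d X -> trap e d' X.
Proof.
move=> dd trapX z r s /trapX[r0 s0 h]; split=> //; case: ifP h => _.
  by move=> h y /h; apply: step_le.
by case=> y ezy h; exists y => //; apply: step_le h.
Qed.

Lemma step_sub d (X Y : T -> R -> R -> Prop) x r s y :
  (forall z a b, X z a b -> Y z a b) -> step d X x r s y -> step d Y x r s y.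
Proof. by move=> XY [a [b [? ? ?]]]; exists a, b; split=> //; exact: XY. Qed.

Lemma trapU e d X Y : trap e d X -> trap e d Y ->
  trap e d (fun z r s => X z r s \/ Y z r s).
Proof.
move=> trapX trapY z r s [/trapX|/trapY] [r0 s0 h]; split=> //; case: ifP h => _.
- by move=> h y /h; apply: step_sub; left.
- by case=> y ezy h; exists y => //; apply: step_sub h; left.
- by move=> h y /h; apply: step_sub; right.
- by case=> y ezy h; exists y => //; apply: step_sub h; right.
Qed.

(** Player 1 interleaves two winning plays: when Player 0 chooses at [x] an edge
    of [e1], the play of [e1] that was suspended at [x] is resumed, and likewise
    for [e2].  The two plays share the credits, so the sums stay bounded from
    below, as the sums of two shuffled sequences are. *)
Lemma trapped_split e e1 e2 x u :
  x \in U -> (forall y, e x y -> e1 x y \/ e2 x y) ->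
  (forall z y, z != x -> e z y = e1 z y /\ e z y = e2 z y) ->
  trapped e1 u -> trapped e1 x -> trapped e2 x -> trapped e u.
Proof.
move=> xV ex eE [da [Xa [da0 trapa [ra [sa Xau]]]]].
move=> [db [Xb [db0 trapb [rb [sb Xbx]]]]] [dc [X2 [dc0 trapc [r2 [s2 X2x]]]]].
pose d := Num.min da (Num.min db dc).
have d0 : 0 < d by rewrite !lt_min da0 db0.
pose X1 z r s := Xa z r s \/ Xb z r s.
have trap1 : trap e1 d X1.
  by apply: trapU; [apply: trap_le trapa|apply: trap_le trapb]; rewrite !ge_min lexx ?orbT.
have trap2 : trap e2 d X2 by apply: trap_le trapc; rewrite !ge_min lexx !orbT.
(* One of the two plays is at [z], the other one waits at [x]. *)
pose X z r s := exists a b a' b', [/\ r = a + a', s = b + b' &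
  X1 z a b /\ X2 x a' b' \/ X1 x a b /\ X2 z a' b'].
have left_step z a b a' b' y : X2 x a' b' -> step d X1 z a b y ->
    step d X z (a + a') (b + b') y.
  move=> X2x' [r' [s' [? ? ?]]]; exists (r' + a'), (s' + b').
  by split; [lra|lra|exists r', s', a', b'; split=> //; left].
have right_step z a b a' b' y : X1 x a b -> step d X2 z a' b' y ->
    step d X z (a + a') (b + b') y.
  move=> X1x' [r' [s' [? ? ?]]]; exists (a + r'), (b + s').
  by split; [lra|lra|exists a, b, r', s'; split=> //; right].
exists d, X; split=> //; last first.
  by exists (ra + r2), (sa + s2), ra, sa, r2, s2; split=> //; left; split=> //; left.
have at_x a b a' b' : X1 x a b -> X2 x a' b' ->
    forall y, e x y -> step d X x (a + a') (b + b') y.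
  move=> h1 h2 y /ex[e1xy|e2xy].
    by apply: left_step => //; have [_ _] := trap1 _ _ _ h1; rewrite xV; apply.
  by apply: right_step => //; have [_ _] := trap2 _ _ _ h2; rewrite xV; apply.
move=> z r s [a [b [a' [b' [-> -> h]]]]]; split.
- by case: h => [[/trap1[? _ _] /trap2[? _ _]]|[/trap1[? _ _] /trap2[? _ _]]]; rewrite addr_ge0.
- by case: h => [[/trap1[_ ? _] /trap2[_ ? _]]|[/trap1[_ ? _] /trap2[_ ? _]]]; rewrite addr_ge0.
have [zx|zx] := eqVneq z x.
  rewrite {}zx in h *; rewrite xV; apply: at_x; by case: h => -[].
case: h => -[h1 h2].
  have [_ _] := trap1 _ _ _ h1; case: ifP => _ h.
    by move=> y ezy; apply: left_step => //; apply: h; rewrite -(eE z y zx).1.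
  by case: h => y ezy h; exists y; [rewrite (eE z y zx).1|apply: left_step].
have [_ _] := trap2 _ _ _ h2; case: ifP => _ h.
  by move=> y ezy; apply: right_step => //; apply: h; rewrite -(eE z y zx).2.
by case: h => y ezy h; exists y; [rewrite (eE z y zx).2|apply: right_step].
Qed.

(** A trap of [e1] that contained [x] would make [x] trapped, so the trap never
    meets the vertex where [e] and [e1] differ. *)
Lemma trapped_avoid e e1 x u :
  (forall z y, z != x -> e z y = e1 z y) ->
  trapped e1 u -> ~ trapped e1 x -> trapped e u.
Proof.
move=> ee1 [d [X [d0 trapX [r [s Xu]]]]] ntx.
exists d, X; split=> //; last by exists r, s.
move=> z a b Xz; have [a0 b0] := trapX _ _ _ Xz.
have zx : z != x by apply/eqP => zx; apply: ntx; exists d, X; split=> //; exists a, b; rewrite -zx.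
by move=> h; split=> //; case: ifP h => _ => [h y|[y]]; rewrite -?ee1 // ?ee1 //; [exact: h|exists y; rewrite ?ee1].
Qed.

Lemma safe_sub e e1 u tau x :
  x \in U -> (forall z y, e1 z y -> e z y) -> (forall z y, z != x -> e z y = e1 z y) ->
  safe e1 u tau -> safe e u tau.
Proof.
move=> xV sub eE [tV su]; split=> [z zV|q c pqc]; first exact: sub (tV z zV).
apply: su; apply: sub_path pqc => z y /andP[ezy zy].
rewrite /obey zy andbT; have [zx|zx] := eqVneq z x; last by rewrite -eE.
by move: zy; rewrite zx xV => /eqP ->; apply: tV.
Qed.

(** Induction on the number of edges of [U].  At a vertex [x] with a choice,
    split the edges of [x] into two nonempty parts.  If [x] is safe in one of
    the two smaller games, a trap of that game avoids [x] and is a trap of [e];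
    otherwise [x] is trapped in both, and the two traps are interleaved. *)
Lemma safe_or_trapped e u : (forall x, exists y, e x y) ->
  (exists tau, safe e u tau) \/ trapped e u.
Proof.
pose mu e := #|[set p : T * T | (p.1 \in U) && e p.1 p.2]%SET|.
move: {2}(mu e).+1 (ltnSn (mu e)) => m; elim: m e u => // m IH e u mum tot.
have [|det] := pickP (fun t : T * T * T =>
  [&& t.1.1 \in U, e t.1.1 t.1.2, e t.1.1 t.2 & t.1.2 != t.2]); last first.
  have [tau tauP] := choice tot.
  have {}det x y y' : x \in U -> e x y -> e x y' -> y = y'.
    by move=> xV exy exy'; have := det (x, y, y'); rewrite /= xV exy exy' /= => /negbFE/eqP.
  case: (pselect (safe e u tau)) => [?|ns]; [by left; exists tau|right].
  apply: contrapT => nt; apply: ns; split=> // q c pqc cn lc.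
  have pqc' : path e u (q ++ c) by apply: sub_path pqc => z y /andP[].
  case: (leP (wsum f0 (last u q) c) 0) => c0; first by left.
  case: (leP (wsum f1 (last u q) c) 0) => c1; first by right.
  by case: nt; apply: trapped_loop pqc' cn lc c0 c1.
move=> [[x y] y'] /= /and4P[xV exy exy' yy'].
pose e1 : rel T := fun z t => e z t && ((z == x) ==> (t != y)).
pose e2 : rel T := fun z t => e z t && ((z == x) ==> (t == y)).
have sub1 z t : e1 z t -> e z t by case/andP.
have sub2 z t : e2 z t -> e z t by case/andP.
have eE1 z t : z != x -> e z t = e1 z t by rewrite /e1 => /negPf ->; rewrite andbT.
have eE2 z t : z != x -> e z t = e2 z t by rewrite /e2 => /negPf ->; rewrite andbT.
have mu1 : (mu e1 < m)%N.
  rewrite -ltnS; apply: leq_trans mum; rewrite ltnS; apply: proper_card; apply/properP; split.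
    by apply/fintype.subsetP => -[z t]; rewrite !inE /= => /andP[-> /sub1].
  by exists (x, y); rewrite !inE /= /e1 ?xV ?exy ?eqxx.
have mu2 : (mu e2 < m)%N.
  rewrite -ltnS; apply: leq_trans mum; rewrite ltnS; apply: proper_card; apply/properP; split.
    by apply/fintype.subsetP => -[z t]; rewrite !inE /= => /andP[-> /sub2].
  by exists (x, y'); rewrite !inE /= /e2 ?xV ?exy' ?eqxx //= eq_sym (negPf yy').
have tot1 z : exists t, e1 z t.
  have [->|zx] := eqVneq z x; first by exists y'; rewrite /e1 exy' eqxx /= eq_sym.
  by have [t] := tot z; rewrite (eE1 _ _ zx); exists t.
have tot2 z : exists t, e2 z t.
  have [->|zx] := eqVneq z x; first by exists y; rewrite /e2 exy !eqxx.
  by have [t] := tot z; rewrite (eE2 _ _ zx); exists t.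
have safe1 z : (exists tau, safe e1 z tau) -> exists tau, safe e z tau.
  by case=> tau h; exists tau; exact: safe_sub xV sub1 eE1 h.
have safe2 z : (exists tau, safe e2 z tau) -> exists tau, safe e z tau.
  by case=> tau h; exists tau; exact: safe_sub xV sub2 eE2 h.
have [/safe1|u1] := IH e1 u mu1 tot1; first by left.
have [[tau tauP]|x1] := IH e1 x mu1 tot1.
  right; apply: trapped_avoid eE1 u1 _; exact: safe_not_trapped tauP.
have [/safe2|u2] := IH e2 u mu2 tot2; first by left.
have [[tau tauP]|x2] := IH e2 x mu2 tot2.
  right; apply: trapped_avoid eE2 u2 _; exact: safe_not_trapped tauP.
right; apply: (@trapped_split e e1 e2 x u) => //.
  move=> t ext; have [->|ty] := eqVneq t y; [right|left].
    by rewrite /e2 exy !eqxx.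
  by rewrite /e1 ext ty implybT.
by move=> z t zx; rewrite -eE1 // -eE2.
Qed.

End Game.
End Dichotomy.

(** * Mean payoffs and sums *)
Section Payoff.
Context {R : realType}.

Lemma ereal_between (x : R) (y : \bar R) : (x%:E < y)%E ->
  exists2 z : R, x < z & (z%:E < y)%E.
Proof.
case: y => [y| |] //=.
- by rewrite lte_fin => xy; exists ((x + y) / 2); rewrite ?lte_fin; lra.
- by move=> _; exists (x + 1); rewrite ?ltry //; lra.
Qed.

Variables (G : arena) (w : G -> G -> int) (pi : nat -> G).

Definition psum (k : nat) : R := \sum_(j < k) (w (pi j) (pi j.+1))%:~R.

Lemma MP_ereal_sup : MP R w pi =
  ereal_sup [set ereal_inf [set (psum k / k%:R)%:E | k in [set k | (n <= k)%N]]%classic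
            | n in [set: nat]]%classic.
Proof.
rewrite /MP limn_einf_lim.
rewrite (_ : (fun k : nat => _) = fun k => (psum k / k%:R)%:E).
  by apply/cvg_lim; [exact: ereal_hausdorff|exact: cvg_einfs_sup].
by apply/funext => k; rewrite /psum raddf_sum.
Qed.

(** The margin [d] comes from the strict inequality: the lower limit exceeds a
    value strictly between it and [b]. *)
Lemma MP_gt (b : R) : (b%:E < MP R w pi)%E ->
  exists2 d : R, 0 < d & exists N, forall k, (N <= k)%N -> (b + d) *+ k <= psum k.
Proof.
rewrite MP_ereal_sup => /ereal_sup_gt[_ [n _ <-]] /ereal_between[z bz zn].
exists (z - b); first by rewrite subr_gt0.
exists n => k nk; rewrite addrC subrK.
case: k nk => [|k] nk; first by rewrite mulr0n /psum big_ord0.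
have : (z%:E < (psum k.+1 / k.+1%:R)%:E)%E.
  by apply: lt_le_trans zn _; apply: ereal_inf_lbound; exists k.+1.
by rewrite lte_fin ltr_pdivlMr ?ltr0n // mulr_natr => /ltW.
Qed.

Lemma MP_ge (m K : R) N : (forall k, (N <= k)%N -> m *+ k - K <= psum k) ->
  (m%:E <= MP R w pi)%E.
Proof.
move=> mK; rewrite MP_ereal_sup; apply/lee_subgt0Pr => e e0.
have [M MP] := mulrn_unbounded K e0.
apply: le_trans (ereal_sup_ubound _); last by exists (N + M).+1%N.
apply: le_ereal_inf_tmp => _ [k /= nk <-].
rewrite -EFinB lee_fin ler_pdivlMr; last by rewrite ltr0n; lia.
rewrite mulrBl !mulr_natr; have : (M <= k)%N by lia.
move=> /MP; have : (N <= k)%N by lia.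
by move=> /mK; lra.
Qed.

Lemma MP_le (W : R) : (forall j, (w (pi j) (pi j.+1))%:~R <= W) -> (MP R w pi <= W%:E)%E.
Proof.
move=> wW; rewrite leNgt; apply/negP => /MP_gt[d d0 [N NP]].
have := NP N.+1 (leqnSn N).
have : psum N.+1 <= \sum_(j < N.+1) W by apply: ler_sum => j _; exact: wW.
rewrite sumr_const card_ord.
have : 0 < d *+ N.+1 by rewrite pmulrn_lgt0.
by rewrite mulrnDl; lra.
Qed.

Lemma MP_ge_const (W : R) : (forall j, W <= (w (pi j) (pi j.+1))%:~R) -> (W%:E <= MP R w pi)%E.
Proof.
move=> wW; apply: (@MP_ge W 0 0) => k _; rewrite subr0.
have : \sum_(j < k) W <= psum k by apply: ler_sum => j _; exact: wW.
by rewrite sumr_const card_ord.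
Qed.

End Payoff.

(** * Plays and strategies *)
Section Strategies.
Context {G : arena}.

(** Only Player 0 is bound to a strategy; these are the outcomes of [s0] against
    all strategies of Player 1, see [Out_consistent] and [consistent_Out]. *)
Definition consistent (s0 : seq G -> G) (v : G) (pi : nat -> G) :=
  [/\ pi 0%N = v, forall k, edge (pi k) (pi k.+1) &
      forall k, pi k \in V0 G -> pi k.+1 = s0 (mkseq pi k.+1)].

Lemma mkseq_path (pi : nat -> G) k : (forall k, edge (pi k) (pi k.+1)) ->
  mkseq pi k.+1 = pi 0%N :: [seq pi l | l <- iota 1 k] /\
  path edge (pi 0%N) [seq pi l | l <- iota 1 k].
Proof. by move=> e; split=> //; apply: path_play. Qed.

Lemma last_mkseq (T : Type) (x : T) (pi : nat -> T) k : last x (mkseq pi k.+1) = pi k.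
Proof. by rewrite mkseqS last_rcons. Qed.

Lemma out_historyE (s0 : strategy (V0 G)) (s1 : strategy (V1 G)) v n :
  out_history s0 s1 v n = mkseq (Out s0 s1 v) n.+1.
Proof.
elim: n => [|n IH] //; rewrite mkseqS -IH /=.
by congr rcons; rewrite /Out /= last_rcons.
Qed.

Lemma OutS (s0 : strategy (V0 G)) (s1 : strategy (V1 G)) v n :
  Out s0 s1 v n.+1 = let h := mkseq (Out s0 s1 v) n.+1 in
    if Out s0 s1 v n \in V0 G then s0 h else s1 h.
Proof. by rewrite {1}/Out /= last_rcons -out_historyE. Qed.

Lemma Out_edge (s0 : strategy (V0 G)) (s1 : strategy (V1 G)) v k :
  edge (Out s0 s1 v k) (Out s0 s1 v k.+1).
Proof.
elim/ltn_ind: k => k IH.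
pose p := [seq Out s0 s1 v l | l <- iota 1 k].
have pp : path edge v p.
  by apply: (@path_play G edge (Out s0 s1 v) 0 k) => l lk; apply: IH; lia.
have lp : last v p = Out s0 s1 v k by rewrite [LHS](last_play (Out s0 s1 v) 0 k).
rewrite OutS /= -/p -lp; case: ifP => lV; apply: moveP => //.
by rewrite inE lV.
Qed.

Lemma Out_consistent (s0 : strategy (V0 G)) (s1 : strategy (V1 G)) v :
  consistent s0 v (Out s0 s1 v).
Proof.
split=> // [k|k kV]; first exact: Out_edge.
by rewrite OutS /= kV.
Qed.

Lemma strategy_along (U : {set G}) (pi : nat -> G) : (forall k, edge (pi k) (pi k.+1)) ->
  exists s : strategy U, forall k, s (mkseq pi k.+1) = pi k.+1.
Proof.
move=> e; have [nx nxP] := choice (@edge_total G).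
pose f (h : seq G) : G := if h == mkseq pi (size h) then pi (size h) else nx (last (pi 0%N) h).
have fP (x : G) p : path edge x p -> last x p \in U -> edge (last x p) (f (x :: p)).
  rewrite /f => _ _; case: eqP => [h|_] //=.
  have -> : last x p = pi (size p) by rewrite -(last_mkseq (pi 0%N)) -[(size p).+1]/(size (x :: p)) -h.
  exact: e.
exists (Strategy fP) => k; by rewrite /= /f size_mkseq eqxx.
Qed.

(** Histories with different first vertices do not interfere, so best responses
    can be chosen separately for each initial vertex. *)
Lemma strategy_glue (U : {set G}) (v : G) (s : G -> strategy U) :
  exists t : strategy U, forall x p, t (x :: p) = s x (x :: p).
Proof.
pose f (h : seq G) : G := if h is x :: p then s x h else v.
have fP (x : G) p : path edge x p -> last x p \in U -> edge (last x p) (f (x :: p)).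
  exact: moveP.
by exists (Strategy fP).
Qed.

Lemma eq_Out (s0 : strategy (V0 G)) (s1 t1 : strategy (V1 G)) v :
  (forall p, t1 (v :: p) = s1 (v :: p)) -> Out s0 t1 v = Out s0 s1 v.
Proof.
move=> ts; apply/funext => n; rewrite /Out; congr last.
elim: n => [|n IH] //=; rewrite IH.
by have := out_historyE s0 s1 v n; rewrite /mkseq /= => ->; rewrite ts.
Qed.

Lemma consistent_Out (s0 : strategy (V0 G)) pi v : consistent s0 v pi ->
  exists s1 : strategy (V1 G), Out s0 s1 v = pi.
Proof.
move=> [pi0 pie pim]; have [s1 s1P] := strategy_along (V1 G) pie.
exists s1; apply/funext.
have H n : out_history s0 s1 v n = mkseq pi n.+1.
  elim: n => [|n IH]; first by rewrite /mkseq /= pi0.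
  rewrite mkseqS /= IH last_mkseq; congr rcons.
  by case: ifP => [/pim|_]; rewrite ?s1P.
by move=> n; rewrite /Out H last_mkseq.
Qed.

End Strategies.

(** * What a value above the threshold provides *)
Section Witness.
Context {R : realType} {G : arena}.

(** Payoffs are bounded, so their supremum is finite; [b] is this supremum less
    [eps], which near-optimal responses exceed. *)
Lemma near_optimal (s0 : strategy (V0 G)) v (eps : R) : 0 < eps ->
  exists (s1 : strategy (V1 G)) (b : R), (b%:E < MP R w1 (Out s0 s1 v))%E /\
    forall s1', (MP R w1 (Out s0 s1' v) - eps%:E <= b%:E)%E.
Proof.
move=> eps0; pose S := [set MP R w1 (Out s0 s1 v) | s1 in [set: strategy (V1 G)]]%classic.
have [W W0 WP] := norm_wsum_bounded (fun x y : G => (w1 x y)%:~R : R).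
have {}WP (x y : G) : `|(w1 x y)%:~R : R| <= W by have := WP x [:: y]; rewrite /= addr0.
have Sub s1 : (MP R w1 (Out s0 s1 v) <= W%:E)%E.
  by apply: MP_le => j; apply: le_trans (ler_norm _) (WP _ _).
have Slb s1 : ((- W)%:E <= MP R w1 (Out s0 s1 v))%E.
  by apply: MP_ge_const => j; have := WP (Out s0 s1 v j) (Out s0 s1 v j.+1); rewrite ler_norml => /andP[].
have [nx nxP] := choice (@edge_total G).
have [sd _] := @strategy_along G (V1 G) (fun k => iter k nx v) (fun k => nxP _).
have Sfin : ereal_sup S \is a fin_num.
  rewrite fin_real //; apply/andP; split.
    apply: lt_le_trans (ereal_sup_ubound _); last by exists sd.
    by apply: lt_le_trans (Slb sd); rewrite ltNyr.
  by apply: le_lt_trans (ltry W); apply: ge_ereal_sup => _ [s1 _ <-].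
have [_ [s1 _ <-] h] := ub_ereal_sup_adherent eps0 Sfin.
exists s1, (fine (ereal_sup S - eps%:E)); rewrite fineK; last by rewrite fin_numB Sfin.
split=> // s1'; apply: leeB => //.
by apply: ereal_sup_ubound; exists s1'.
Qed.

(** A consistent play from [v] whose payoff for Player 1 exceeds [b] is the
    outcome of an approximate best response: follow it from [v], and play
    near-optimally from the other vertices. *)
Lemma ASV_gt_witness (v : G) (c : R) : (c%:E < ASV R v)%E ->
  exists (s0 : strategy (V0 G)) (c' b : R) (pi : nat -> G),
  [/\ c < c', consistent s0 v pi, (b%:E < MP R w1 pi)%E &
    forall rho, consistent s0 v rho -> (b%:E < MP R w1 rho)%E -> (c'%:E <= MP R w0 rho)%E].
Proof.
move=> /ereal_sup_gt[_ [s0 _ <-]] /ereal_sup_gt[_ [eps /= eps0 <-]].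
move=> /ereal_between[c' cc' c'P].
have [s1 s1P] := choice (fun v => near_optimal s0 v eps0).
have [b [bP bS]] := s1P v.
exists s0, c', b, (Out s0 (s1 v) v); split=> //; first exact: Out_consistent.
move=> rho crho brho; have [t tE] := consistent_Out crho.
have [t' t'P] := strategy_glue v (fun x => if x == v then t else s1 x).
have t'v : Out s0 t' v = rho.
  by rewrite -tE; apply: eq_Out => p; rewrite t'P eqxx.
have t'x x : x != v -> Out s0 t' x = Out s0 (s1 x) x.
  by move=> xv; apply: eq_Out => p; rewrite t'P (negPf xv).
have t'BR : BR eps s0 t'.
  move=> x s'; have [->|xv] := eqVneq x v; last first.
    by rewrite t'x //; have [bx [h1 h2]] := s1P x; apply: le_lt_trans h1.
  by rewrite t'v; apply: le_lt_trans brho.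
apply: le_trans (ltW c'P) _; apply: ereal_inf_lbound.
by exists t' => //; rewrite t'v.
Qed.

End Witness.

(** * Rounding thresholds to small denominators *)
Section Rounding.
Context {R : realType}.
(** [r] is the greatest fraction of denominator at most [D] not above [b], so such
    fractions exceed [b] as soon as they exceed [r]. *)
Lemma round_down_threshold (b : R) (D : nat) : (0 < D)%N ->
  exists (X : int) (Y : nat), let r := X%:~R / Y%:R : R in
  [/\ (0 < Y <= D)%N, r <= b, b - 1 < r &
    forall (X' : int) (Y' : nat), (0 < Y' <= D)%N -> r *+ Y' < X'%:~R ->
      b *+ Y' < X'%:~R].
Proof.
case: D => // D _.
pose F (i : 'I_D.+1) : R := (Num.floor (b *+ i.+1))%:~R / i.+1%:R.
have [j _ jmax] := @arg_maxP _ _ _ ord0 xpredT F isT.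
exists (Num.floor (b *+ j.+1)), j.+1; rewrite -/(F j); split=> //.
- by rewrite ltn_ord.
- by rewrite ler_pdivrMr ?ltr0n // mulr_natr; exact: floor_le.
- apply: lt_le_trans (jmax ord0 isT); rewrite /F /= mulr1n divr1 ltrBlDr.
  by have := floorD1_gt b; rewrite rmorphD.
move=> X' [//|Y'] Y'D; rewrite !ltNge; apply: contra => Xb.
have := jmax (Ordinal Y'D) isT; rewrite {1}/F /= ler_pdivrMr ?ltr0n // mulr_natr.
by apply: le_trans; rewrite ler_int floor_ge_int.
Qed.

(** Two distinct fractions [X / Y] and [X' / Y'] differ by at least
    [1 / (Y Y')]. *)
Lemma rounded_gap (X X' : int) (Y Y' : nat) : (0 < Y)%N ->
  (X%:~R / Y%:R : R) *+ Y' < X'%:~R ->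
  1 <= Y%:R * (X'%:~R - (X%:~R / Y%:R : R) *+ Y').
Proof.
move=> Y0; have Yp : 0 < Y%:R :> R by rewrite ltr0n.
move=> h; have {}h : 0 < Y%:R * (X'%:~R - (X%:~R / Y%:R : R) *+ Y').
  by rewrite mulr_gt0 // subr_gt0.
have E : Y%:R * (X'%:~R - (X%:~R / Y%:R : R) *+ Y') = (Y%:Z * X' - X * Y'%:Z)%:~R.
  rewrite rmorphB !rmorphM /= -mulr_natr; have /gt_eqF/negbT := Yp => ?; field.
  by [].
by move: h; rewrite E ltr0z ler1z.
Qed.
End Rounding.

(** * Punishing deviations positionally *)
Section Facts.
Context {R : realType} {G : arena}.

Definition tail (pi : nat -> G) N := fun l => pi (N + l)%N.

Lemma psum_tail (w : G -> G -> int) pi N m :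
  psum w pi (N + m) = psum w pi N + psum w (tail pi N) m :> R.
Proof.
rewrite /psum big_split_ord /=; congr (_ + _); apply: eq_bigr => j _.
by rewrite /tail addnS.
Qed.

Definition above (w : G -> G -> int) (b : R) x y : R := (w x y)%:~R - b.
Definition below (w : G -> G -> int) (b : R) x y : R := b - (w x y)%:~R.

Lemma wsum_above w b x p : wsum (above w b) x p = (wsum w x p)%:~R - b *+ size p.
Proof. by rewrite wsumD wsum_const wsum_intr mulNrn. Qed.

Lemma wsum_below w b x p : wsum (below w b) x p = b *+ size p - (wsum w x p)%:~R.
Proof.
rewrite /below wsumD wsum_const; congr (_ + _).
by elim: p x => [|y p IH] x /=; rewrite ?oppr0 // IH rmorphD opprD.
Qed.

Lemma sum_above w b (pi : nat -> G) k : \sum_(j < k) above w b (pi j) (pi j.+1) = psum w pi k - b *+ k.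
Proof. by rewrite big_split /= sumr_const card_ord mulNrn. Qed.

Lemma sum_below w b (pi : nat -> G) k : \sum_(j < k) below w b (pi j) (pi j.+1) = b *+ k - psum w pi k.
Proof. by rewrite big_split /= sumr_const card_ord sumrN. Qed.

(** If [y] were trapped, the prefix of [pi] could be continued, consistently
    with [s0], by a play whose payoffs are more than [b] for Player 1 and less
    than [c'] for Player 0. *)
Lemma deviation_safe (s0 : strategy (V0 G)) (v : G) (c' b : R) pi k y :
  (forall rho, consistent s0 v rho -> (b%:E < MP R w1 rho)%E -> (c'%:E <= MP R w0 rho)%E) ->
  consistent s0 v pi -> pi k \notin V0 G -> edge (pi k) y ->
  exists tau, safe (V0 G) (below w0 c') (above w1 b) edge y tau.
Proof.
move=> good [pi0 pie pim] pik eky.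
have [//|[d [X [d0 trapX [r [s Xy]]]]]] := safe_or_trapped (V0 G) (below w0 c') (above w1 b) y (@edge_total G).
exfalso.
have [hE hp] := mkseq_path k pie.
have lh : last (pi 0%N) [seq pi l | l <- iota 1 k] = pi k by rewrite last_play.
have [p pp pV|rho [rho0 rhoe rhom h0 h1]] :=
    play_in_trap (mv := fun h => s0 (mkseq pi k.+1 ++ h)) trapX Xy.
  rewrite hE /=; have := @moveP _ _ s0 (pi 0%N) ([seq pi l | l <- iota 1 k] ++ y :: p).
  by rewrite last_cat cat_path /= hp lh eky => /(_ pp); apply.
pose full j := if (j <= k)%N then pi j else rho (j - k.+1)%N.
have fulls j : (j <= k)%N -> full j = pi j by rewrite /full => ->.
have fullb j : full (k.+1 + j)%N = rho j by rewrite /full leqNgt addSn ltnS leq_addr /= subSS addKn.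
have mks j : (j <= k)%N -> mkseq full j.+1 = mkseq pi j.+1.
  by move=> jk; apply/eq_in_map => l; rewrite mem_iota => /andP[_ lj]; apply: fulls; lia.
have mkb j : mkseq full (k.+1 + j).+1 = mkseq pi k.+1 ++ mkseq rho j.+1.
  rewrite -addnS /mkseq iotaD map_cat; congr (_ ++ _); first exact: mks.
  by rewrite add0n -[k.+1 in X in iota X]addn0 iotaDl -map_comp; apply: eq_map => l /=; exact: fullb.
have cases j : (j < k)%N \/ j = k \/ exists i, j = (k.+1 + i)%N.
  case: (ltngtP j k); [by left| |by right; left].
  by move=> kj; right; right; exists (j - k.+1)%N; lia.
have cfull : consistent s0 v full.
  split; first by rewrite fulls.
    move=> j; case: (cases j) => [jk|[->|[i ->]]].
    - by rewrite !fulls //; lia.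
    - by rewrite fulls // -[k.+1]addn0 fullb rho0.
    - by rewrite -addnS !fullb.
  move=> j; case: (cases j) => [jk|[->|[i ->]]].
  - by rewrite mks ?fulls //; first exact: pim; lia.
  - by rewrite fulls // (negPf pik).
  - by rewrite mkb -addnS !fullb => /rhom.
have tailE : tail full k.+1 = rho by apply/funext => j; exact: fullb.
have MP1 : (b%:E < MP R w1 full)%E.
  apply: lt_le_trans (@MP_ge _ _ _ _ (b + d) (s - psum w1 full k.+1 + (b + d) *+ k.+1) k.+1 _).
    by rewrite lte_fin ltrDl.
  move=> n kn; rewrite -(subnKC kn) psum_tail tailE; set m := (n - k.+1)%N.
  have H := h1 m; rewrite sum_above in H.
  by clear - H; lra.
have /MP_gt[d' d'0 [N NP]] : ((c' - d / 2)%:E < MP R w0 full)%E.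
  by apply: lt_le_trans (good _ cfull MP1); rewrite lte_fin; lra.
have d20 : 0 < d / 2 by lra.
have [M MP] := mulrn_unbounded (r + psum w0 full k.+1 - (c' - d / 2) *+ k.+1) d20.
pose n := (N + M)%N.
have {NP} H1 := NP (k.+1 + n)%N (leq_trans (leq_addr M N) (leq_addl _ _)).
have {MP} H2 := MP n (leq_addl _ _).
have {h0} H3 := h0 n; rewrite sum_below in H3.
have H4 : 0 <= d' *+ (k.+1 + n) by rewrite mulrn_wge0 // ltW.
rewrite psum_tail tailE in H1.
clear - H1 H2 H3 H4; lra.
Qed.
End Facts.

(** * Punishment with rounded thresholds *)
Section Combine.
Context {T : finType} {R : realType}.

(** Only the sources of edges need to be connected: the relations considered are
    sets of edges, and vertices outside them do not matter. *)
Definition strongly_connected (F : rel T) :=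
  forall x y x' y', F x y -> F x' y' -> connect F x x'.

(** Many repetitions of two loops, in fixed proportions, outweigh the walks
    between them. *)
Lemma positive_loop (F : rel T) (g0 g1 : T -> T -> R) x1 c1 x2 c2 k1 k2 :
  strongly_connected F ->
  path F x1 c1 -> c1 != [::] -> last x1 c1 = x1 ->
  path F x2 c2 -> c2 != [::] -> last x2 c2 = x2 ->
  (forall g, g = g0 \/ g = g1 -> 0 < wsum g x1 c1 *+ k1 + wsum g x2 c2 *+ k2) ->
  exists c, [/\ path F x1 c, c != [::], last x1 c = x1 & 0 < wsum g0 x1 c /\ 0 < wsum g1 x1 c].
Proof.
move=> sc p1 n1 l1 p2 n2 l2 pos.
have [y1 Fy1] : exists y, F x1 y by case: (c1) p1 n1 => //= y ? /andP[]; exists y.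
have [y2 Fy2] : exists y, F x2 y by case: (c2) p2 n2 => //= y ? /andP[]; exists y.
have [r [pr sr H]] := repeat_two_loops p1 l1 p2 l2 (sc _ _ _ _ Fy1 Fy2) (sc _ _ _ _ Fy2 Fy1).
have [M0 M0P] := mulrn_unbounded (- wsum g0 x1 r) (pos _ (or_introl erefl)).
have [M1 M1P] := mulrn_unbounded (- wsum g1 x1 r) (pos _ (or_intror erefl)).
pose N := (M0 + M1)%N.
have [c [pc lc sz cE]] := H (k1 * N)%N (k2 * N)%N.
have s0 : 0 < wsum g0 x1 c.
  rewrite cE !mulrnA -mulrnDl; have := M0P N (leq_addr _ _); lra.
exists c; split=> //; first by case: (c) s0 => //=; rewrite ltxx.
split=> //; rewrite cE !mulrnA -mulrnDl; have := M1P N (leq_addl _ _); lra.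
Qed.
End Combine.

Section Punish.
Context {R : realType} {G : arena}.
Variables (p q : int) (W : nat).
Hypothesis q0 : 0 < q.
Let c : R := p%:~R / q%:~R.

(** An integer multiple of [w0 - c], with the sign of [w0 - c]. *)
Definition scaled (x y : G) : int := q * w0 x y - p.
Hypothesis scaledW : forall x y : G, edge x y -> (`|scaled x y| <= W)%N.

Lemma wsum_scaled x s : q%:~R * wsum (below w0 c) x s = - (wsum scaled x s)%:~R :> R.
Proof.
have q00 : q%:~R != 0 :> R by rewrite intr_eq0 gt_eqF.
rewrite -wsumZ -wsum_intr -mulN1r -wsumZ; apply: eq_wsum => y z.
rewrite /below /scaled rmorphB rmorphM /= /c; field.
by [].
Qed.

Lemma scaled_size (F : rel G) x s : (forall x y, F x y -> edge x y) -> path F x s ->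
  (`|wsum scaled x s| <= W * size s)%N.
Proof.
move=> FE ps; rewrite -lez_nat abszE PoszM.
apply: le_trans (@norm_wsum_le G _ edge scaled W x s _ _) _.
- by move=> y z /scaledW; rewrite -lez_nat abszE.
- exact: sub_path ps.
- by rewrite -mulr_natr natz.
Qed.

Variables (c' b r : R) (D : nat).
Hypothesis cc' : c < c'.
Hypothesis roundr : forall (X : int) (Y : nat), (0 < Y <= D)%N -> r *+ Y < X%:~R ->
  b *+ Y < X%:~R.
Hypothesis D1 : (#|G| <= D)%N.
Hypothesis D2 : (2 * (W * #|G| * #|G|) <= D)%N.

(** The pair of thresholds [(c, r)] inherits a separating line from the absence
    of loops that beat [(c', b)].  If a short loop beat [(c, r)], it would beat
    [(c', b)], because its mean for Player 1 is a fraction of denominator at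
    most [D].  If a combination of two short loops did so, the combination with
    mean exactly [c] for Player 0 would have such a mean as well, and its
    repetition would yield a loop that beats [(c', b)]. *)
Lemma component_tradeoff (F : rel G) : (forall x y, F x y -> edge x y) ->
  strongly_connected F ->
  (forall x s, path F x s -> s != [::] -> last x s = x ->
    wsum (below w0 c') x s <= 0 \/ wsum (above w1 b) x s <= 0) ->
  exists2 k : R, 0 <= k & exists K : R, forall x s, path F x s ->
    k * wsum (below w0 c) x s + wsum (above w1 r) x s <= K.
Proof.
move=> FE sc no.
have q00 : 0 < q%:~R :> R by rewrite ltr0z.
have [[x [s [ps sn ss ls [s0 s1]]]]|[x1 [s1 [x2 [s2 [[p1 n1 z1 l1] [p2 n2 z2 l2] [a1 b1] [a2 b2] h]]]]]|//]
  := planar_walk_alternative F (below w0 c) (above w1 r); exfalso.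
  have s00 : (0 < size s)%N by rewrite lt0n size_eq0.
  have b0 : 0 < wsum (above w1 b) x s.
    move: s1; rewrite !wsum_above !subr_gt0; apply: roundr.
    by rewrite s00 (leq_trans ss).
  have c0 : 0 < wsum (below w0 c') x s.
    move: s0; rewrite !wsum_below => s0.
    have : c *+ size s < c' *+ size s by rewrite ltr_pMn2r.
    lra.
  by have [] := no x s ps sn ls; rewrite leNgt ?b0 ?c0.
pose A1 := wsum scaled x1 s1; pose A2 := wsum scaled x2 s2.
have A1E := wsum_scaled x1 s1; have A2E := wsum_scaled x2 s2.
have A10 : A1 < 0.
  have : 0 < q%:~R * wsum (below w0 c) x1 s1 by rewrite mulr_gt0.
  by rewrite A1E oppr_gt0 ltrz0.
have A20 : 0 < A2.
  have : q%:~R * wsum (below w0 c) x2 s2 < 0 by rewrite pmulr_rlt0.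
  by rewrite A2E oppr_lt0 ltr0z.
(* These proportions make the sums of [w0 - c] cancel. *)
pose k1 := `|A2|%N; pose k2 := `|A1|%N.
have k1E : k1%:R = - (q%:~R * wsum (below w0 c) x2 s2) :> R.
  by rewrite A2E opprK -/A2 /k1 -[in RHS](gtz0_abs A20).
have k2E : k2%:R = q%:~R * wsum (below w0 c) x1 s1 :> R.
  by rewrite A1E -/A1 -mulrNz /k2 -[in RHS](ltz0_abs A10).
have k10 : (0 < k1)%N by rewrite absz_gt0 gt_eqF.
have L10 : (0 < size s1)%N by rewrite lt0n size_eq0.
pose Y := (k1 * size s1 + k2 * size s2)%N.
pose X : int := wsum w1 x1 s1 *+ k1 + wsum w1 x2 s2 *+ k2.
have Y0 : (0 < Y)%N by rewrite /Y addn_gt0 muln_gt0 k10 L10.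
have YD : (Y <= D)%N.
  apply: leq_trans D2; rewrite mul2n -addnn.
  have B1 := scaled_size FE p1; have B2 := scaled_size FE p2.
  apply: leq_add; apply: leq_mul => //.
    by apply: leq_trans B2 _; rewrite leq_mul2l z2 orbT.
  by apply: leq_trans B1 _; rewrite leq_mul2l z1 orbT.
have XE t : X%:~R - t *+ Y = wsum (above w1 t) x1 s1 *+ k1 + wsum (above w1 t) x2 s2 *+ k2.
  rewrite !wsum_above /X rmorphD !rmorphMn /= /Y; ring.
have Xr : r *+ Y < X%:~R.
  rewrite -subr_gt0 XE -[_ *+ k1]mulr_natr -[_ *+ k2]mulr_natr k1E k2E.
  have : 0 < q%:~R * (wsum (below w0 c) x1 s1 * wsum (above w1 r) x2 s2
                     - wsum (below w0 c) x2 s2 * wsum (above w1 r) x1 s1).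
    by rewrite mulr_gt0 // subr_gt0.
  lra.
have Xb : b *+ Y < X%:~R by apply: roundr Xr; rewrite Y0.
have [|s [ps sn ls [h0 h1]]] := @positive_loop _ _ F (below w0 c') (above w1 b) x1 s1 x2 s2 k1 k2
   sc p1 n1 l1 p2 n2 l2.
  move=> g [->|->]; last by rewrite -XE subr_gt0.
  have : 0 < (c' - c) *+ Y by rewrite pmulrn_lgt0 // subr_gt0.
  have : wsum (below w0 c) x1 s1 *+ k1 + wsum (below w0 c) x2 s2 *+ k2 = 0.
    by rewrite -[_ *+ k1]mulr_natr -[_ *+ k2]mulr_natr k1E k2E; ring.
  rewrite !wsum_below /Y; lra.
by have [] := no x1 s ps sn ls; rewrite leNgt ?h0 ?h1.
Qed.

(** The play ends in a strongly connected set of edges, where the line of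
    [component_tradeoff] turns a surplus [e] of Player 1 over [r] into a surplus
    of Player 0 over [c].  There are finitely many such sets, hence a common
    bound [L] on the slopes, which depends neither on the play nor on [e]. *)
Lemma punishing_bound tau u : safe (V0 G) (below w0 c') (above w1 b) edge u tau ->
  exists2 L : R, 0 < L & forall (e : R) rho, 0 < e -> rho 0%N = u ->
    (forall k, obey (V0 G) tau edge (rho k) (rho k.+1)) ->
    ((r + e)%:E < MP R w1 rho)%E -> ((c + e / L)%:E <= MP R w0 rho)%E.
Proof.
move=> [tauV0 safeu].
pose admissible (F : {set G * G}) := [/\ forall x y, in_edges F x y -> obey (V0 G) tau edge x y,
  strongly_connected (in_edges F) &
  forall x y, in_edges F x y -> exists2 s, path (obey (V0 G) tau edge) u s & last u s = x].
have /choice[la laP] : forall F, exists la : R, 0 <= la /\ (admissible F -> exists K : R,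
    forall x s, path (in_edges F) x s -> la * wsum (below w0 c) x s + wsum (above w1 r) x s <= K).
  move=> F; case: (pselect (admissible F)) => [[sub sc reach]|no]; last by exists 0.
  have [||k k0 [K KP]] := @component_tradeoff (in_edges F) _ sc.
  - by move=> x y /sub /andP[].
  - move=> x s ps sn ls.
    have [y Fxy] : exists y, in_edges F x y by case: (s) ps sn => //= y ? /andP[]; exists y.
    have [t pt lt] := reach _ _ Fxy.
    rewrite -lt; apply: safeu => //; last by rewrite last_cat lt.
    by rewrite cat_path pt lt; apply: sub_path ps => z z' /sub.
  by exists k; split=> // _; exists K.
pose L := 1 + \sum_F la F.
have laL F : la F <= L.
  rewrite /L (bigD1 F) //= addrCA lerDl addr_ge0 //; apply: sumr_ge0 => F' _.
  by case: (laP F').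
have L0 : 0 < L by rewrite ltr_pwDl // sumr_ge0 // => F _; case: (laP F).
exists L => // e rho e0 rho0 rhoP rhoM.
have [N NP] := eventually_recurrent rho.
pose F := recurrent rho.
have admF : admissible F.
  split.
  - by move=> x y /recurrentP/(_ 0%N)[k _ [<- <-]].
  - by move=> x y x' y'; exact: recurrent_connect.
  - move=> x y /recurrentP/(_ 0%N)[k _ [<- _]].
    exists [seq rho l | l <- iota 1 k]; rewrite -rho0; last by rewrite last_play.
    exact: path_play.
have [la0 /(_ admF)[K KP]] := laP F.
have [d d0 [N' N'P]] := MP_gt rhoM.
have key k : (N' <= k)%N -> la F * (c *+ k - psum w0 (tail rho N) k) + (e *+ k + r *+ N + e *+ N
    - psum w1 rho N) <= K.
  move=> kN; have := KP (rho N) [seq rho l | l <- iota N.+1 k] _.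
  rewrite path_play => [/(_ isT)|l /andP[/NP]//].
  rewrite !wsum_play.
  rewrite (_ : \sum_(l < k) _ = c *+ k - psum w0 (tail rho N) k); last first.
    by rewrite -sum_below; apply: eq_bigr => l _; rewrite /tail addnS.
  rewrite (_ : \sum_(l < k) above _ _ _ _ = psum w1 (tail rho N) k - r *+ k); last first.
    by rewrite -sum_above; apply: eq_bigr => l _; rewrite /tail addnS.
  have := N'P (N + k)%N; rewrite psum_tail => /(_ ltac:(lia)).
  have : 0 <= d *+ (N + k) by rewrite mulrn_wge0 // ltW.
  by lra.
have laF : 0 < la F.
  rewrite lt_neqAle la0 andbT; apply/eqP => la00.
  have [M MP] := mulrn_unbounded (K - (r *+ N + e *+ N - psum w1 rho N)) e0.
  have := key (N' + M)%N (leq_addr _ _); have := MP (N' + M)%N (leq_addl _ _).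
  by rewrite -la00 mul0r; lra.
pose C := (K - (r *+ N + e *+ N - psum w1 rho N)) / la F.
apply: (@le_trans _ _ (c + e / la F)%:E).
  by rewrite lee_fin lerD2l ler_pM2l // lef_pV2 ?posrE.
apply: (@MP_ge _ _ _ _ _ (C - psum w0 rho N + (c + e / la F) *+ N) (N + N')%N) => k kN.
rewrite -(subnKC (leq_trans (leq_addr N' N) kN)) psum_tail; set m := (k - N)%N.
have := key m ltac:(lia).
have : la F * (c *+ m + (e / la F) *+ m - C) = la F * (c *+ m) + (e *+ m + r *+ N + e *+ N
    - psum w1 rho N) - K.
  rewrite /C; field. by rewrite gt_eqF.
move=> E1 E2; have {}E2 : la F * (c *+ m + (e / la F) *+ m - C) <= la F * psum w0 (tail rho N) m by lra.
rewrite ler_pM2l // in E2.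
clear - E2; lra.
Qed.

End Punish.

(** * A short loop that is good for both players *)
Lemma loop_size_arith (t u n : nat) :
  ((t + (u + 1)) * n + t * n + 2 * n = (2 * t + u + 3) * n)%N.
Proof. ring. Qed.

Section Loop.
Context {R : realType} {G : arena}.
Variables (p q : int) (W V D : nat).
Hypothesis q0 : 0 < q.
Let c : R := p%:~R / q%:~R.
Hypothesis scaledW : forall x y : G, edge x y -> (`|scaled p q x y| <= W)%N.

(** How many times a balanced combination of two short loops is repeated in
    [short_rewarding_loop]: enough for gaps of at least [1 / D] to outweigh
    costs of at most [V] per edge on the connecting walk and the extra rounds. *)
Definition loop_repeat (n : nat) := (D * (2 * n * W + 3) * n * V + 1)%N.
Definition loop_size (n : nat) :=
  ((2 * (loop_repeat n * W * n) + 2 * n * W + 3) * n)%N.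

Variables (c' b : R) (X0 : int) (Y0 : nat).
Let r : R := X0%:~R / Y0%:R.
Hypothesis cc' : c < c'.
Hypothesis Y0D : (0 < Y0 <= D)%N.
Hypothesis rb : r <= b.
Hypothesis aboveV : forall x y : G, edge x y -> `|above w1 r x y| <= V%:R.

Lemma wsum_scaled_above (t : R) (x : G) s : (wsum (scaled p q) x s : int)%:~R =
  q%:~R * (wsum (above w0 t) x s + (t - c) *+ size s) :> R.
Proof.
have := @wsum_scaled R G p q q0 x s; rewrite wsum_below wsum_above => E.
rewrite -[LHS]opprK -E /c; ring.
Qed.

(** If no short loop beats [(t, b)], with [t] between [c] and [c'], and no two
    short loops have a combination that does, then a separating line bounds a
    combination of the sums along [pi] with nonnegative coefficients, although
    the payoffs of [pi] force it to infinity. *)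
Lemma short_rewarding_loop pi : (forall k, edge (pi k) (pi k.+1)) ->
  (c'%:E <= MP R w0 pi)%E -> (b%:E < MP R w1 pi)%E ->
  exists (x : G) s, [/\ path (in_edges (recurrent pi)) x s, s != [::], last x s = x,
    (size s <= loop_size #|G|)%N &
    0 < wsum (scaled p q) x s /\ r *+ size s < (wsum w1 x s)%:~R].
Proof.
move=> pie MPpi0 MPpi1; pose t := (c + c') / 2.
have [ct tc'] := midf_lt cc'; rewrite -/t in ct tc'.
have q00 : 0 < q%:~R :> R by rewrite ltr0z.
pose n := #|G|.
have n0 : (0 < n)%N by apply/card_gt0P; exists (pi 0%N).
have nl : (n <= loop_size n)%N by rewrite /loop_size leq_pmull //; lia.
have FE (x y : G) : in_edges (recurrent pi) x y -> edge x y.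
  by move=> /recurrentP/(_ 0%N)[k _ [<- <-]].
have single (x : G) s : path (in_edges (recurrent pi)) x s -> s != [::] -> (size s <= n)%N ->
    last x s = x -> 0 < wsum (scaled p q) x s -> 0 < wsum (above w1 b) x s ->
    exists (x : G) s, [/\ path (in_edges (recurrent pi)) x s, s != [::], last x s = x,
    (size s <= loop_size #|G|)%N &
    0 < wsum (scaled p q) x s /\ r *+ size s < (wsum w1 x s)%:~R].
  move=> ps sn ss ls A0 B0; exists x, s; split=> //; first exact: leq_trans nl.
  split=> //; move: B0; rewrite wsum_above subr_gt0; apply: le_lt_trans.
  exact: ler_wMn2r.
have [[x [s [ps sn ss ls [h0 h1]]]]|[x1 [s1 [x2 [s2 [[p1 n1 z1 l1] [p2 n2 z2 l2] [a1 b1] [a2 b2] h]]]]]|]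
  := planar_walk_alternative (in_edges (recurrent pi)) (above w0 t) (above w1 b).
- apply: (single x s) => //; rewrite -(ltr0z R) (wsum_scaled_above t).
  by rewrite mulr_gt0 // ltr_wpDl // pmulrn_rgt0 ?subr_gt0 // lt0n size_eq0.
- pose A1 := wsum (scaled p q) x1 s1; pose A2 := wsum (scaled p q) x2 s2.
  case: (ltP 0 A2) => A20; first by apply: (single x2 s2).
  have sz1 : (0 < size s1)%N by rewrite lt0n size_eq0.
  have A10 : 0 < A1.
    by rewrite -(ltr0z R) (wsum_scaled_above t) mulr_gt0 // addr_gt0 // pmulrn_rgt0 ?subr_gt0.
  pose k1 := `|A2|%N; pose k2 := `|A1|%N.
  have k1E : k1%:R = - A2%:~R :> R by rewrite -mulrNz -[in RHS](lez0_abs A20).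
  have k2E : k2%:R = A1%:~R :> R by rewrite -[in RHS](gtz0_abs A10).
  pose Y := (k1 * size s1 + k2 * size s2)%N.
  pose X : int := wsum w1 x1 s1 *+ k1 + wsum w1 x2 s2 *+ k2.
  have XE u : X%:~R - u *+ Y = wsum (above w1 u) x1 s1 *+ k1 + wsum (above w1 u) x2 s2 *+ k2.
    rewrite !wsum_above /X rmorphD !rmorphMn /= /Y; ring.
  have Xb : b *+ Y < X%:~R.
    rewrite -subr_gt0 XE -[_ *+ k1]mulr_natr -[_ *+ k2]mulr_natr k1E k2E.
    rewrite /A1 /A2 !(wsum_scaled_above t).
    have : 0 < q%:~R * (wsum (above w0 t) x1 s1 * wsum (above w1 b) x2 s2
             - wsum (above w0 t) x2 s2 * wsum (above w1 b) x1 s1).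
      by rewrite mulr_gt0 // subr_gt0.
    have : 0 <= q%:~R * ((t - c) * (wsum (above w1 b) x2 s2 *+ size s1)).
      apply: mulr_ge0; first exact: ltW.
      by apply: mulr_ge0; [rewrite subr_ge0 ltW|rewrite mulrn_wge0 // ltW].
    have : 0 <= q%:~R * ((t - c) * (- wsum (above w1 b) x1 s1 *+ size s2)).
      apply: mulr_ge0; first exact: ltW.
      by apply: mulr_ge0; [rewrite subr_ge0 ltW|rewrite mulrn_wge0 // oppr_ge0].
    lra.
  have gap : 1 <= D%:R * (X%:~R - r *+ Y).
    have rY : r *+ Y < X%:~R by apply: le_lt_trans Xb; exact: ler_wMn2r.
    have /andP[Y00 YD] := Y0D.
    apply: le_trans (rounded_gap Y00 rY) _; rewrite ler_wpM2r ?ler_nat //.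
    by rewrite ltW // subr_gt0.
  have [y1 Fy1] : exists y, in_edges (recurrent pi) x1 y by case: (s1) p1 n1 => //= y ? /andP[]; exists y.
  have [y2 Fy2] : exists y, in_edges (recurrent pi) x2 y by case: (s2) p2 n2 => //= y ? /andP[]; exists y.
  have [j [pj sj H]] := repeat_two_loops p1 l1 p2 l2 (recurrent_connect Fy1 Fy2) (recurrent_connect Fy2 Fy1).
  (* [N] times the balanced combination gives the gap over [r] for Player 1 and
     nothing for Player 0; [m] further rounds of the first loop pay for the
     connecting walk, of length at most [2 n], on the side of Player 0. *)
  pose m := (2 * n * W + 1)%N; pose N := loop_repeat n.
  have [s [ps ls sz sE]] := H (N * k1 + m)%N (N * k2)%N.
  have Wn (x : G) u : path (in_edges (recurrent pi)) x u -> (size u <= n)%N ->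
      (`|wsum (scaled p q) x u| <= W * n)%N.
    move=> pu un; apply: leq_trans (scaled_size scaledW FE pu) _.
    by rewrite leq_mul2l un orbT.
  have k1W := Wn _ _ p2 z2; have k2W := Wn _ _ p1 z1.
  have szs : (size s <= loop_size n)%N.
    rewrite sz /loop_size -/N.
    have g1 : ((N * k1 + m) * size s1 <= (N * W * n + m) * n)%N.
      by apply: leq_mul => //; rewrite leq_add2r -mulnA leq_mul2l k1W orbT.
    have g2 : (N * k2 * size s2 <= N * W * n * n)%N.
      by apply: leq_mul => //; rewrite -mulnA leq_mul2l k2W orbT.
    have g3 : (size j <= 2 * n)%N by [].
    apply: leq_trans (leq_add (leq_add g1 g2) g3) _; by rewrite /m loop_size_arith.
  have As : 0 < wsum (scaled p q) x1 s.
    rewrite sE -/A1 -/A2.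
    have wj : - (W * (2 * n))%:Z <= wsum (scaled p q) x1 j.
      rewrite lerNl; apply: le_trans (ler_norm _) _; rewrite normrN -abszE lez_nat.
      by apply: leq_trans (scaled_size scaledW FE pj) _; rewrite leq_mul2l sj orbT.
    have wm : (W * (2 * n))%:Z < m%:Z by rewrite ltz_nat /m mulnC addn1 ltnS.
    have -> : A2 *+ (N * k2) = - (A1 *+ (N * k1)).
      rewrite -mulr_natr -[in RHS]mulr_natr !natrM !natz.
      rewrite /k1 /k2 (lez0_abs A20) (gtz0_abs A10); ring.
    have hm : m%:Z <= A1 *+ m by rewrite -[leLHS]natz ler_wMn2r // -gtz0_ge1.
    rewrite mulrnDr [A1 *+ _ + _]addrC addrK.
    by apply: lt_le_trans (lerD hm wj); rewrite subr_gt0.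
  exists x1, s; split=> //.
    by case: (s) As => //=; rewrite ltxx.
  split=> //; rewrite -subr_gt0 -wsum_above sE.
  have Vn (x : G) u k : path (in_edges (recurrent pi)) x u -> (size u <= k)%N ->
      - (V * k)%:R <= wsum (above w1 r) x u.
    move=> pu uk; have := @norm_wsum_le G R edge (above w1 r) V%:R x u aboveV (sub_path FE pu).
    rewrite ler_norml => /andP[+ _]; apply: le_trans; rewrite lerN2 natrM mulr_natr.
    by apply: ler_wpMn2l.
  have v1 := Vn _ _ _ p1 z1; have vj := Vn _ _ _ pj sj.
  have e : wsum (above w1 r) x1 s1 *+ (N * k1 + m) + wsum (above w1 r) x2 s2 *+ (N * k2) =
    (X%:~R - r *+ Y) *+ N + wsum (above w1 r) x1 s1 *+ m by rewrite XE; ring.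
  rewrite e.
  have v1m : - (V * n * m)%:R <= wsum (above w1 r) x1 s1 *+ m.
    by rewrite natrM mulr_natr -mulNrn; exact: ler_wMn2r.
  have E : (X%:~R - r *+ Y) *+ N = (D%:R * (X%:~R - r *+ Y)) * ((2 * n * W + 3) * n * V)%:R + (X%:~R - r *+ Y).
    rewrite /N /loop_repeat; ring.
  have E2 : ((2 * n * W + 3) * n * V)%:R <= (D%:R * (X%:~R - r *+ Y)) * ((2 * n * W + 3) * n * V)%:R :> R.
    by rewrite ler_peMl.
  have gp : 0 < X%:~R - r *+ Y.
    by rewrite -(pmulr_rgt0 _ (x := D%:R)) ?(lt_le_trans _ gap) // ltr0n; case/andP: Y0D => /leq_trans; apply.
  have E3 : ((2 * n * W + 3) * n * V)%:R = (V * n * m)%:R + (V * (2 * n))%:R :> R.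
    by rewrite /m; ring.
  rewrite E; lra.
- case=> k k0 [K KP]; exfalso.
  have [N NP] := eventually_recurrent pi.
  have : (t%:E < MP R w0 pi)%E by apply: lt_le_trans MPpi0; rewrite lte_fin.
  move=> /MP_gt[d d0 [N0 N0P]]; have [d' d'0 [N1 N1P]] := MP_gt MPpi1.
  have key m : (N0 + N1 <= m)%N -> d' *+ (N + m) <= K + k * (psum w0 pi N - t *+ N) + (psum w1 pi N - b *+ N).
    move=> mN; have := KP (pi N) [seq pi l | l <- iota N.+1 m] _.
    rewrite path_play => [/(_ isT)|l /andP[/NP]//].
    rewrite !wsum_play.
    rewrite (_ : \sum_(l < m) above w0 _ _ _ = psum w0 (tail pi N) m - t *+ m); last first.
      by rewrite -sum_above; apply: eq_bigr => l _; rewrite /tail addnS.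
    rewrite (_ : \sum_(l < m) above w1 _ _ _ = psum w1 (tail pi N) m - b *+ m); last first.
      by rewrite -sum_above; apply: eq_bigr => l _; rewrite /tail addnS.
    have := N0P (N + m)%N (leq_trans (leq_trans (leq_addr _ _) mN) (leq_addl _ _)).
    have := N1P (N + m)%N (leq_trans (leq_trans (leq_addl _ _) mN) (leq_addl _ _)).
    rewrite !psum_tail => h1 h0 h2.
    have d0m : 0 <= d *+ (N + m) by rewrite mulrn_wge0 // ltW.
    have {}h0 : 0 <= k * (psum w0 pi N + psum w0 (tail pi N) m - t *+ (N + m)).
      by rewrite mulr_ge0 // subr_ge0 (le_trans _ h0) // mulrnDl lerDl.
    lra.
  have [M MP] := mulrn_unbounded (K + k * (psum w0 pi N - t *+ N) + (psum w1 pi N - b *+ N)) d'0.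
  have := key (N0 + N1 + M)%N (leq_addr _ _).
  have := MP (N + (N0 + N1 + M))%N (leq_trans (leq_addl _ _) (leq_addl _ _)); lra.
Qed.

End Loop.

(** * The machine *)
Section Lasso.
Context {T : finType} {R : realType}.

Lemma wsum_take (g : T -> T -> R) x p i : (i < size p)%N ->
  wsum g x (take i.+1 p) = wsum g x (take i p) + g (nth x (x :: p) i) (nth x (x :: p) i.+1).
Proof.
elim: p x i => [|y p IH] x [|i] //= ip; first by rewrite take0 /= addr0 add0r.
rewrite IH // addrA; congr (_ + g _ _); last exact: set_nth_default.
by case: i ip => //= i ip; apply: set_nth_default; apply: ltnW.
Qed.

(** A finite cyclic list of positions that walks along [p] once and then along
    the loop [s] forever; its sums grow at the rate of the mean of [s]. *)
Lemma lasso_walk (e : rel T) v p s : path e v p -> path e (last v p) s -> s != [::] ->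
  last (last v p) s = last v p ->
  exists (I : finType) (i0 : I) (nx : I -> I) (vx : I -> T),
  [/\ #|I| = (size p + size s)%N, vx i0 = v, forall i, e (vx i) (vx (nx i)) &
    forall g : T -> T -> R, exists K, forall k,
      (wsum g (last v p) s / (size s)%:R) *+ k - K <=
      \sum_(j < k) g (vx (iter j nx i0)) (vx (iter j.+1 nx i0))].
Proof.
move=> pp ps sn ls; pose L := (size p + size s)%N.
have s0 : (0 < size s)%N by rewrite lt0n size_eq0.
have L0 : (0 < L)%N by rewrite addn_gt0 s0 orbT.
have pL : (size p < L)%N by rewrite -addn1 leq_add2l.
pose t := p ++ s; have tL : size t = L by rewrite size_cat.
pose V i := nth v (v :: t) i.
have lt : last v t = last v p by rewrite last_cat.
pose nx (i : 'I_L) : 'I_L :=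
  if insub i.+1 is Some j then j else Ordinal pL.
have nxE (i : 'I_L) : V (nx i) = V i.+1.
  rewrite /nx; case: insubP => [j _ -> //|]; rewrite -leqNgt => Li /=.
  have -> : i.+1 = L by apply/eqP; rewrite eqn_leq ltn_ord.
  rewrite /V -[X in _ = nth _ _ X]tL -last_nth lt (last_nth v).
  by rewrite -[v :: t]cat_cons nth_cat ltnSn.
have Ve i : (i < L)%N -> e (V i) (V i.+1).
  have : path e v t by rewrite cat_path pp.
  by move/pathP => h iL; apply: (h v); rewrite tL.
exists ('I_L : finType), (Ordinal L0), nx, (fun i : 'I_L => V i); split=> //.
- by rewrite card_ord.
- by move=> i; rewrite nxE; apply: Ve.
move=> g; set m := wsum g _ s / _.
(* A potential: each step of the lasso changes it by the excess of the weight
   over the mean [m], also the step that closes the loop. *)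
pose h i := wsum g v (take i t) - m *+ i.
have hS i : (i < L)%N -> h i.+1 = h i + (g (V i) (V i.+1) - m).
  by move=> iL; rewrite /h wsum_take ?tL // mulrS; ring.
have hL : h L = h (size p).
  rewrite /h -{1}tL take_size take_size_cat // wsum_cat /L mulrnDr.
  have -> : m *+ size s = wsum g (last v p) s.
    by rewrite -mulr_natr divfK // pnatr_eq0 -lt0n.
  ring.
have hnx (i : 'I_L) : h (nx i) = h i + (g (V i) (V (nx i)) - m).
  rewrite nxE -hS // /nx; case: insubP => [j _ -> //|]; rewrite -leqNgt => Li /=.
  have -> : i.+1 = L by apply/eqP; rewrite eqn_leq ltn_ord.
  by [].
exists (\sum_(i < L) `|h i| + h 0%N) => k.
have -> : \sum_(j < k) g (V (iter j nx (Ordinal L0))) (V (iter j.+1 nx (Ordinal L0)))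
    = m *+ k + h (iter k nx (Ordinal L0)) - h 0%N.
  elim: k => [|k IH]; first by rewrite big_ord0 /= mulr0n; ring.
  by rewrite big_ord_recr IH /= hnx mulrS; ring.
set i := iter k nx _.
have : - h i <= \sum_(i < L) `|h i|.
  rewrite (bigD1 i) //=; apply: le_trans (ler_norm _) _; rewrite normrN lerDl.
  exact: sumr_ge0.
lra.
Qed.
End Lasso.

Section Follow.
Context {G : arena}.
Variables (I : finType) (i0 : I) (nx : I -> I) (vx : I -> G) (tau : G -> G -> G).
Hypothesis vx_edge : forall i, edge (vx i) (vx (nx i)).
Hypothesis tau_edge : forall u x, x \in V0 G -> edge x (tau u x).

(** In state [inl i] the play is expected at [vx i]; in state [inr u] it was
    first seen off the lasso at [u], and [tau u] is played. *)
Definition track (st : I + G) (x : G) : I + G :=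
  match st with
  | inl i => if x == vx i then inl (nx i) else inr x
  | inr u => inr u
  end.

Definition reply (st : I + G) (x : G) : G :=
  match st with
  | inl i => if x == vx i then vx (nx i) else tau x x
  | inr u => tau u x
  end.

(** The value at the empty sequence, which is not a history, is arbitrary. *)
Definition follow (h : seq G) : G :=
  if h is x :: p then reply (foldl track (inl i0) (belast x p)) (last x p) else vx i0.

Lemma followP (x : G) p : path edge x p -> last x p \in V0 G ->
  edge (last x p) (follow (x :: p)).
Proof.
rewrite /follow => _ lV; case: (foldl _ _ _) => [i|u] /=; last exact: tau_edge.
by case: eqP => [->|_]; [exact: vx_edge | exact: tau_edge].
Qed.

Definition follow_strategy : strategy (V0 G) := Strategy followP.

Lemma follow_memory : has_memory follow_strategy #|{: I + G}|.
Proof.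
exists (@Machine G #|{: I + G}| (enum_rank (inl i0))
  (fun st x => enum_rank (track (enum_val st) x)) (fun st x => reply (enum_val st) x)).
move=> x p _ _ /=; congr reply.
elim: (belast x p) (inl i0 : I + G) => [|y s IH] st /=; first by rewrite enum_rankK.
by rewrite enum_rankK IH.
Qed.

Let lp k := vx (iter k nx i0).

Lemma follow_mkseq rho k : follow_strategy (mkseq rho k.+1) = reply (foldl track (inl i0) (mkseq rho k)) (rho k).
Proof.
have E : rho 0%N :: [seq rho i | i <- iota 1 k] = rcons (mkseq rho k) (rho k).
  exact: mkseqS.
have := lastI (rho 0%N) [seq rho i | i <- iota 1 k]; rewrite E => /rcons_inj[e1 e2].
by rewrite -[LHS]/(follow _) /follow {1}/mkseq /= -e1 -e2.
Qed.

Lemma lasso_consistent : consistent follow_strategy (vx i0) lp.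
Proof.
have st k : foldl track (inl i0) (mkseq lp k) = inl (iter k nx i0).
  elim: k => [|k IH] //; rewrite mkseqS -cats1 foldl_cat IH /= /lp eqxx //.
split=> // [k|k _]; first exact: vx_edge.
by rewrite follow_mkseq st /= /lp eqxx.
Qed.

(** Player 0 never leaves the lasso first, and all that happens after a
    deviation is played against [tau]. *)
Lemma follow_cases rho : consistent follow_strategy (vx i0) rho ->
  rho = lp \/ exists k, [/\ rho k = lp k, rho k \notin V0 G &
    forall j, obey (V0 G) (tau (rho k.+1)) edge (tail rho k.+1 j) (tail rho k.+1 j.+1)].
Proof.
move=> [rho0 rhoe rhom].
case: (pselect (forall k, rho k = lp k)) => [h|]; first by left; apply/funext.
move=> /existsNP[m0 nm]; right.
have ex : exists k, rho k != lp k by exists m0; apply/eqP.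
case: (ex_minnP ex) => -[|k]; first by rewrite rho0 eqxx.
move=> nk kmin.
have agree j : (j <= k)%N -> rho j = lp j.
  by move=> jk; apply/eqP; apply: contraT => /kmin; rewrite ltnNge jk.
have st j : (j <= k.+1)%N -> foldl track (inl i0) (mkseq rho j) = inl (iter j nx i0).
  elim: j => [|j IH] // jk; rewrite mkseqS -cats1 foldl_cat IH /=; last exact: ltnW.
  by rewrite agree // /lp eqxx.
exists k; split; first exact: agree.
  apply/negP => kV; move: nk; rewrite rhom // follow_mkseq.
  by rewrite (st k) //= (agree k) // /lp !eqxx.
move=> j; rewrite /obey /tail addnS rhoe /=; apply/implyP => jV.
have st' : forall l, foldl track (inl i0) (mkseq rho (k.+1 + l).+1) = inr (rho k.+1).
  elim=> [|l IH]; last by rewrite mkseqS -cats1 foldl_cat addnS IH.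
  by rewrite addn0 mkseqS -cats1 foldl_cat st //= (negPf nk).
apply/eqP; rewrite rhom // follow_mkseq; case: j jV => [|j] jV; last by rewrite addnS st'.
by rewrite addn0 st //= (negPf nk).
Qed.
End Follow.

(** * The value of the strategy *)
Section Value.
Context {R : realType}.

Lemma ereal_le_approx (x y : \bar R) :
  (forall b : R, (b%:E < x)%E -> (b%:E <= y)%E) -> (x <= y)%E.
Proof.
move=> h; rewrite leNgt; apply/negP => yx.
have [z yz zx] : exists2 z : R, (y < z%:E)%E & (z%:E < x)%E.
  case: y yx {h} => [y /ereal_between[z yz zx]||].
  - by exists z; rewrite ?lte_fin.
  - by rewrite ltNge leey.
  - case: x => [x _|_|] //; last by exists 0; rewrite ?ltry ?ltNyr.
    by exists (x - 1); rewrite ?ltNyr // lte_fin; lra.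
by have := h _ zx; rewrite leNgt yz.
Qed.

(** Mean payoffs do not depend on finite prefixes. *)
Lemma MP_tail (G : arena) (w : G -> G -> int) pi N : MP R w (tail pi N) = MP R w pi.
Proof.
apply/eqP; rewrite eq_le; apply/andP; split; apply: ereal_le_approx => b /MP_gt[d d0 [M H]].
  apply: (@MP_ge _ _ _ _ b (b *+ N - psum w pi N) (N + M)%N) => k kN.
  have Nk : (N <= k)%N by apply: leq_trans kN; exact: leq_addr.
  have Mk : (M <= k - N)%N by rewrite leq_subRL.
  rewrite -(subnKC Nk) psum_tail; have := H _ Mk.
  set m := (k - N)%N; have : 0 <= d *+ m by rewrite mulrn_wge0 // ltW.
  lra.
apply: (@MP_ge _ _ _ _ b (psum w pi N - b *+ N) M) => k kM.
have := H (N + k)%N (leq_trans kM (leq_addl _ _)); rewrite psum_tail.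
have : 0 <= d *+ (N + k) by rewrite mulrn_wge0 // ltW.
lra.
Qed.

(** The lasso is available to Player 1, so a response within [(m1 - r) / 2] of
    the best one earns more than the midpoint of [r] and [m1].  Either its
    outcome is the lasso, or it deviates, and then [punish] applies; the least
    of the finitely many guarantees still exceeds [c]. *)
Lemma follow_value (G : arena) (I : finType) (i0 : I) (nx : I -> I) (vx : I -> G)
    (tau : G -> G -> G) (vx_edge : forall i, edge (vx i) (vx (nx i)))
    (tau_edge : forall u x, x \in V0 G -> edge x (tau u x)) (c r m0 m1 : R) (L : G -> R) :
  let lp k := vx (iter k nx i0) in
  c < m0 -> r < m1 -> (m0%:E <= MP R w0 lp)%E -> (m1%:E <= MP R w1 lp)%E ->
  (forall y, 0 < L y) ->
  (forall i y, vx i \notin V0 G -> edge (vx i) y -> forall (e : R) rho, 0 < e -> rho 0%N = y ->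
    (forall k, obey (V0 G) (tau y) edge (rho k) (rho k.+1)) ->
    ((r + e)%:E < MP R w1 rho)%E -> ((c + e / L y)%:E <= MP R w0 rho)%E) ->
  (c%:E < ASV_strat R (follow_strategy i0 vx_edge tau_edge) (vx i0))%E.
Proof.
move=> lp cm0 rm1 h0 h1 L0 punish; set s := follow_strategy _ _ _.
pose e := (m1 - r) / 2; have e0 : 0 < e by rewrite /e; lra.
pose B := \sum_y L y; have LB y : L y <= B.
  by rewrite /B (bigD1 y) //= lerDl; apply: sumr_ge0 => z _; exact: ltW.
have B0 : 0 < B by apply: lt_le_trans (LB (vx i0)).
pose z := Num.min m0 (c + e / B).
have cz : c < z by rewrite lt_min cm0 ltrDl divr_gt0.
apply: (@lt_le_trans _ _ z%:E); first by rewrite lte_fin.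
apply: (@le_trans _ _ (ereal_inf [set MP R w0 (Out s s1 (vx i0)) | s1 in BR e s]%classic)); last first.
  by apply: ereal_sup_ubound; exists e.
apply: le_ereal_inf_tmp => _ [s1 s1BR <-].
have cons := Out_consistent s s1 (vx i0).
have [->|[k [rk rV dev]]] := follow_cases cons.
  by apply: le_trans h0; rewrite lee_fin ge_min lexx.
have [s2 s2E] := consistent_Out (lasso_consistent i0 vx_edge tau_edge).
have := s1BR (vx i0) s2; rewrite s2E => M1.
set rho := Out s s1 (vx i0) in cons rk rV dev M1 *.
have [_ rhoe _] := cons.
have := punish (iter k nx i0) (rho k.+1); rewrite -rk => /(_ rV (rhoe k)).
move=> /(_ e (tail rho k.+1) e0); rewrite {1}/tail addn0 !MP_tail => /(_ erefl dev) H.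
apply: le_trans (H _); last first.
  apply: le_lt_trans M1; apply: (@le_trans _ _ (m1%:E - e%:E)%E); last exact: leeB.
  by rewrite -EFinB lee_fin /e; lra.
rewrite lee_fin ge_min; apply/orP; right; rewrite lerD2l ler_pM2l // lef_pV2 ?posrE //.
Qed.

End Value.

(** * The pseudopolynomial bound *)
Section Bound.

(** Here [n] stands for the number of vertices and [m] for a bound on the
    weights and on the numerator and the denominator of [c]; the weights of
    [scaled] are then at most [W], the distances from weights to [r] at most
    [2 m + 2], and the denominators of the means in play at most the argument
    of [loop_size] in the place of [D]. *)
Definition memory_bound (n m : nat) : nat :=
  let W := (m * m + m)%N in
  (2 * n + loop_size W (2 * m + 2) (2 * (W * n * n) + n) n)%N.

Lemma memory_bound_mono n n' m : (n <= n')%N -> (memory_bound n m <= memory_bound n' m)%N.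
Proof.
move=> nn; rewrite /memory_bound /loop_size /loop_repeat.
by repeat first [exact: nn | exact: leqnn | apply: leq_add | apply: leq_mul].
Qed.

(** The polynomial is the same expression, evaluated at the two variables. *)
Lemma memory_bound_poly : exists P : {poly {poly nat}}, forall n m : nat,
  P.[n%:P].[m] = memory_bound n m.
Proof.
pose n : {poly {poly nat}} := 'X; pose m : {poly {poly nat}} := ('X)%:P.
pose W := m * m + m; pose V := 2%:R * m + 2%:R; pose D := 2%:R * (W * n * n) + n.
pose N := D * (2%:R * n * W + 3%:R) * n * V + 1%:R.
exists (2%:R * n + (2%:R * (N * W * n) + 2%:R * n * W + 3%:R) * n) => a b.
(* Evaluation commutes with the operations; rewriting with these four rules
   is far cheaper than unfolding the polynomials. *)
pose ev (p : {poly {poly nat}}) : nat := p.[a%:P].[b].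
have evD p q : ev (p + q) = (ev p + ev q)%N by rewrite /ev !hornerD.
have evM p q : ev (p * q) = (ev p * ev q)%N by rewrite /ev !hornerM.
have evk k : ev k%:R = k.
  elim: k => [|k IH]; first by rewrite /ev !horner0.
  by rewrite -natr1 evD IH /ev -polyC1 !hornerC addn1.
have evn : ev n = a by rewrite /ev hornerX hornerC.
have evm : ev m = b by rewrite /ev hornerC hornerX.
rewrite -[LHS]/(ev _) /memory_bound /loop_size /loop_repeat.
by rewrite !(evD, evM, evk, evn, evm).
Qed.

End Bound.

Section Magnitude.
Context {G : arena} (c : rat).
Let m := input_magnitude G c.

Lemma magnitude_w0 (x y : G) : edge x y -> (`|w0 x y| <= m)%N.
Proof.
move=> exy; rewrite /m /input_magnitude leq_max; apply/orP; left.
apply: leq_trans (leq_bigmax_cond (F := fun e : G * G => maxn `|w0 e.1 e.2| `|w1 e.1 e.2|) (x, y) exy).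
exact: leq_maxl.
Qed.

Lemma magnitude_w1 (x y : G) : edge x y -> (`|w1 x y| <= m)%N.
Proof.
move=> exy; rewrite /m /input_magnitude leq_max; apply/orP; left.
apply: leq_trans (leq_bigmax_cond (F := fun e : G * G => maxn `|w0 e.1 e.2| `|w1 e.1 e.2|) (x, y) exy).
exact: leq_maxr.
Qed.

Lemma magnitude_scaled (x y : G) : edge x y ->
  (`|scaled (numq c) (denq c) x y| <= m * m + m)%N.
Proof.
move=> exy; have w := magnitude_w0 exy.
have hn : (`|numq c| <= m)%N by rewrite /m /input_magnitude !leq_max leqnn orbT.
have hd : (`|denq c| <= m)%N by rewrite /m /input_magnitude !leq_max leqnn !orbT.
rewrite /scaled; apply: (@leq_trans (`|(denq c * w0 x y)%R|%N + `|numq c|%N)%N).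
  by rewrite -lez_nat PoszD !abszE; exact: ler_normB.
by rewrite abszM; apply: leq_add => //; apply: leq_mul.
Qed.

Lemma card_le_input_size : (#|G| <= input_size G c)%N.
Proof.
rewrite /input_size -!addnA; apply: leq_trans (leq_addr _ _).
by rewrite mulnS leq_addr.
Qed.
End Magnitude.

(** * The theorem *)
Lemma bounded_memory_strategy (R : realType) (G : arena) (v : G) (c : rat) :
  ((ratr c)%:E < ASV R v)%E ->
  exists (s0 : strategy (V0 G)) (M : nat),
    [/\ has_memory s0 M, (M <= memory_bound #|G| (input_magnitude G c))%N
      & ((ratr c)%:E < ASV_strat R s0 v)%E].
Proof.
move=> /ASV_gt_witness[s [c' [b0 [pi [cc' pis b0pi good0]]]]].
have [pi0 pie pim] := pis.
set m := input_magnitude G c; set n := #|G|.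
pose W := (m * m + m)%N; pose V := (2 * m + 2)%N; pose D := (2 * (W * n * n) + n)%N.
pose p := numq c; pose q := denq c; have q0 : 0 < q by exact: denq_gt0.
have scaledW (x y : G) : edge x y -> (`|scaled p q x y| <= W)%N by exact: magnitude_scaled.
have w1m (x y : G) : edge x y -> `|(w1 x y)%:~R : R| <= m%:R.
  by move=> /(magnitude_w1 c); rewrite -(ler_nat R) -intr_norm -abszE.
(* The threshold is raised if necessary, so that its rounding is bounded. *)
pose b := Num.max b0 (- m%:R - 1).
have pi_lo : ((- m%:R)%:E <= MP R w1 pi)%E.
  by apply: MP_ge_const => j; have := w1m _ _ (pie j); rewrite ler_norml => /andP[].
have pi_hi : (MP R w1 pi <= m%:R%:E)%E.
  by apply: MP_le => j; have := w1m _ _ (pie j); rewrite ler_norml => /andP[].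
have bpi : (b%:E < MP R w1 pi)%E.
  rewrite /b EFin_max gt_max b0pi /=; apply: lt_le_trans pi_lo.
  by rewrite lte_fin; lra.
have good rho : consistent s v rho -> (b%:E < MP R w1 rho)%E -> (c'%:E <= MP R w0 rho)%E.
  move=> cr br; apply: good0 => //; apply: le_lt_trans br.
  by rewrite lee_fin le_max lexx.
have n0 : (0 < n)%N by apply/card_gt0P; exists v.
have D0 : (0 < D)%N by rewrite addn_gt0 n0 orbT.
have [X [Y [YD rb br rround]]] := round_down_threshold b D0.
set r := X%:~R / Y%:R in rb br rround.
have bm : b < m%:R by rewrite -(lte_fin (R := R)); exact: lt_le_trans pi_hi.
have bl : - m%:R - 1 <= b by rewrite le_max lexx orbT.
have aboveV (x y : G) : edge x y -> `|above w1 r x y| <= V%:R.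
  move=> /w1m; rewrite !ler_norml /above /V natrD natrM => /andP[h1 h2].
  by apply/andP; split; lra.
have piM0 := good _ pis bpi.
have [x [u [pu un lu szu [Au Bu]]]] := short_rewarding_loop q0 scaledW cc' YD rb aboveV pie piM0 bpi.
pose E : rel G := fun x y => `[< exists k, pi k = x /\ pi k.+1 = y >].
have EP y z : E y z -> exists k, pi k = y /\ pi k.+1 = z by move/asboolP.
have EF y z : in_edges (recurrent pi) y z -> E y z.
  by move=> /recurrentP/(_ 0%N)[k _ kE]; apply/asboolP; exists k.
have Eedge y z : E y z -> edge y z by move=> /EP[k [<- <-]].
have [k kx] : exists k, pi k = x.
  have [y] : exists y, in_edges (recurrent pi) x y by case: (u) pu un => //= y ? /andP[]; exists y.
  by move=> /recurrentP/(_ 0%N)[k _ [<- _]]; exists k.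
have /connect_short_path[t [pt lt szt]] : connect E v x.
  apply/connectP; exists [seq pi l | l <- iota 1 k]; rewrite -pi0 ?last_play //.
  by apply: path_play => l _; apply/asboolP; exists l.
have pu' : path E (last v t) u by rewrite lt; apply: sub_path pu.
have lu' : last (last v t) u = last v t by rewrite lt.
have [I [i0 [nx [vx [cardI vx0 vxE vxsum]]]]] := lasso_walk (R := R) pt pu' un lu'.
pose f0 : G -> G -> R := below w0 c'; pose f1 : G -> G -> R := above w1 b.
have [nxt nxtP] := choice (@edge_total G).
have /choice[tau tauP] : forall y : G, exists tau : G -> G,
    (forall x, x \in V0 G -> edge x (tau x)) /\
    ((exists t, safe (V0 G) f0 f1 edge y t) -> safe (V0 G) f0 f1 edge y tau).
  move=> y; case: (pselect (exists t, safe (V0 G) f0 f1 edge y t)) => [[t' t'P]|no].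
    by exists t'; split=> //; case: t'P.
  by exists nxt; split.
have tau_edge y x' : x' \in V0 G -> edge x' (tau y x') by move=> h; apply: (tauP y).1.
have vx_edge i : edge (vx i) (vx (nx i)) by apply: Eedge.
have D1 : (#|G| <= D)%N by rewrite leq_addl.
have D2 : (2 * (W * #|G| * #|G|) <= D)%N by rewrite leq_addr.
have /choice[L LP] : forall y : G, exists L : R, 0 < L /\
    ((exists t, safe (V0 G) f0 f1 edge y t) ->
    forall (e : R) rho, 0 < e -> rho 0%N = y ->
    (forall k, obey (V0 G) (tau y) edge (rho k) (rho k.+1)) ->
    ((r + e)%:E < MP R w1 rho)%E -> ((ratr c + e / L)%:E <= MP R w0 rho)%E).
  move=> y; case: (pselect (exists t, safe (V0 G) f0 f1 edge y t)) => [h|no]; last by exists 1.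
  have [L L0 LP] := punishing_bound q0 scaledW cc' rround D1 D2 ((tauP y).2 h).
  by exists L; split=> // _; exact: LP.
exists (follow_strategy i0 vx_edge tau_edge), #|{: I + G}|; split.
- exact: follow_memory.
- rewrite card_sum cardI /memory_bound -/m -/n -/W -/V -/D mul2n -addnn.
  by rewrite addnAC; apply: leq_add; rewrite ?leq_add.
- rewrite -vx0.
  have su : 0 < (size u)%:R :> R by rewrite ltr0n lt0n size_eq0.
  apply: (@follow_value R G I i0 nx vx tau vx_edge tau_edge (ratr c) r
     ((wsum w0 x u)%:~R / (size u)%:R) ((wsum w1 x u)%:~R / (size u)%:R) L).
  + rewrite ltr_pdivlMr //; have q00 : 0 < q%:~R :> R by rewrite ltr0z.
    have := @wsum_scaled R G p q q0 x u; rewrite wsum_below => h.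
    have : 0 < (wsum (scaled p q) x u)%:~R :> R by rewrite ltr0z.
    rewrite -[_%:~R]opprK -h oppr_gt0 pmulr_rlt0 // subr_lt0 mulr_natr; exact.
  + by rewrite ltr_pdivlMr // mulr_natr.
  + have [K KP] := vxsum (fun x y => (w0 x y)%:~R).
    by apply: (@MP_ge _ _ _ _ _ K 0) => j _; have := KP j; rewrite lt wsum_intr.
  + have [K KP] := vxsum (fun x y => (w1 x y)%:~R).
    by apply: (@MP_ge _ _ _ _ _ K 0) => j _; have := KP j; rewrite lt wsum_intr.
  + by move=> y; case: (LP y).
  + move=> i y iV ey; apply: (LP y).2.
    have [j [ji _]] := EP _ _ (vxE i).
    by rewrite -ji in iV ey; exact: deviation_safe good pis iV ey.
Qed.

Theorem theorem18 (R : realType) :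
  exists P : {poly {poly nat}},
    forall (G : arena) (v : G) (c : rat),
      ((ratr c)%:E < ASV R v)%E ->
      exists (s0 : strategy (V0 G)) (M : nat),
        [/\ has_memory s0 M,
            (M <= P.[(input_size G c)%:P].[input_magnitude G c])%N
          & ((ratr c)%:E < ASV_strat R s0 v)%E].
Proof.
have [P PE] := memory_bound_poly; exists P => G v c /bounded_memory_strategy[s0 [M [h1 h2 h3]]].
exists s0, M; split=> //; rewrite PE; apply: leq_trans h2 _.
exact/memory_bound_mono/card_le_input_size.
Qed.
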